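(* Let $(S,\mathfrak m,k)$ and $(T,\mathfrak n,k)$ be generalized Golod Artinian Gorenstein local rings with common residue field $k$, each of length at least three. Assume that the embedding dimension of $S$ is at least $2$. Then the connected sum $S\# T$ satisfies Tor-vanishing.
   Context: All rings are commutative Noetherian local rings with $1\neq 0$, and all modules are finitely generated. Connected sum: let $(S,\mathfrak m,k)$, $(T,\mathfrak n,k)$ be Artinian Gorenstein local rings whose one-dimensional socles are generated by $s$ and $t$ respectively, and let $\pi_S:S\to k$, $\pi_T:T\to k$ be the canonical surjections. The fiber product is $S\times_k T=\{(x,y)\in S\times T:\pi_S(x)=\pi_T(y)\}$, and the connected sum is $S\# T=(S\times_k T)/((s,-t))$, the quotient by the ideal generated by $(s,-t)$ (for the chosen socle generators $s,t$). Tor-vanishing: a local ring $R$ satisfies Tor-vanishing if for all finitely generated $R$-modules $M,N$, $\operatorname{Tor}^R_i(M,N)=0$ for all $i\gg0$ implies that $M$ or $N$ has finite projective dimension. Acyclic closure: for a local ring $(R,\mathfrak m,k)$, the acyclic closure $R\langle X\rangle$ of $k$ over $R$ is the DG $R$-algebra resolution of $k$ obtained from $R$ by Tate's process of killing cycles in a minimal way: one adjoins exterior variables in odd degrees and divided power variables in even degrees, the degree $1$ variables being mapped by the differential onto a minimal generating set of $\mathfrak m$, and, for $n\ge 1$, the degree $n+1$ variables being mapped to cycles whose classes form a minimal generating set of $H_n(R\langle X_{\le n}\rangle)$. Here $R\langle X_{\le n}\rangle$ is the DG subalgebra generated by the variables of degree at most $n$. Trivial Massey operation: let $U$ be such a DG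 algebra with augmentation $U\to k$, and set $\overline a=(-1)^{d+1}a$ for $a\in U_d$ (extended additively). $U$ admits a trivial Massey operation if to each finite sequence $v_1,\dots,v_n$ ($n\ge 1$) of elements of $\widetilde H(U)=\ker(H(U)\to k)$ one can assign an element $\gamma(v_1,\dots,v_n)\in\ker(U\to k)$ such that (i) $\gamma(v)$ is a cycle representing the homology class $v$ for each $v\in\widetilde H(U)$, and (ii) $d\gamma(v_1,\dots,v_n)=\sum_{j=1}^{n-1}\overline{\gamma(v_1,\dots,v_j)}\,\gamma(v_{j+1},\dots,v_n)$. Generalized Golod ring: $R$ is generalized Golod (of level $\le q$, where $q\geq 1$) if $R\langle X_{\le q}\rangle$ admits a trivial Massey operation; $R$ is generalized Golod if this holds for some $q$. *)

(* Defs.v *)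
From HB Require Import structures.
From mathcomp Require Import all_boot all_order all_algebra.
From mathcomp Require Import all_classical.

Set Implicit Arguments.
Unset Strict Implicit.
Unset Printing Implicit Defensive.

Import GRing.Theory.

Local Open Scope classical_set_scope.
Local Open Scope ring_scope.
Local Open Scope quotient_scope.

Section Ideals.
Variable R : comNzRingType.
Implicit Types (I m : set R) (s : seq R).

Definition is_ideal I :=
  [/\ I 0, forall x y, I x -> I y -> I (x + y) & forall a x, I x -> I (a * x)].

Definition generates I s :=
  forall x, I x <-> exists c : 'I_(size s) -> R, x = \sum_(i < size s) c i * s`_i.

Definition noetherian := forall I, is_ideal I -> exists s, generates I s.

Definition artinian :=
  forall I : nat -> set R, (forall n, is_ideal (I n)) ->
    (forall n, I n.+1 `<=` I n) -> exists N, forall n, (N <= n)%N -> I n = I N.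

Definition maximal_ideal m :=
  [/\ is_ideal m, ~ m 1 &
      forall I, is_ideal I -> ~ I 1 -> m `<=` I -> I = m].

Definition local_ring m :=
  [/\ noetherian, maximal_ideal m & forall I, maximal_ideal I -> I = m].

Definition residue_map m (k : fieldType) (p : {rmorphism R -> k}) :=
  (forall y, exists x, p x = y) /\ (forall x, p x = 0 <-> m x).

(* The length of R as a module over itself is at least l: it is the supremum
   of the lengths of strictly increasing chains of ideals. *)
Definition length_ge (l : nat) :=
  exists I : nat -> set R,
    (forall i, (i <= l)%N -> is_ideal (I i)) /\
    (forall i, (i < l)%N -> I i `<` I i.+1).

(* The embedding dimension is the least number of generators of m. *)
Definition embdim_ge m (e : nat) := forall s, generates m s -> (e <= size s)%N.

Definition socle m : set R := [set x | forall a, m a -> a * x = 0].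

Definition socle_generator m (x : R) :=
  x != 0 /\ socle m = [set y | exists a, y = a * x].

End Ideals.

Section Modules.
Variable R : comPzRingType.
Implicit Types M N : lmodType R.

Definition finitely_generated M :=
  exists n (g : 'I_n -> M),
    forall x, exists c : 'I_n -> R, x = \sum_(i < n) c i *: g i.

Definition exact_at (A B C : lmodType R) (f : A -> B) (g : B -> C) :=
  forall y, g y = 0 <-> exists x, f x = y.

Definition projective_module (P : lmodType R) :=
  forall (A B : lmodType R) (f : {linear A -> B}) (h : {linear P -> B}),
    (forall y, exists x, f x = y) ->
    exists h' : {linear P -> A}, forall x, f (h' x) = h x.

Definition injective_module (E : lmodType R) :=
  forall (A B : lmodType R) (f : {linear A -> B}) (h : {linear A -> E}),
    injective f -> exists h' : {linear B -> E}, forall x, h' (f x) = h x.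

Definition finite_projdim M :=
  exists (P : nat -> lmodType R) (d : forall n, {linear P n.+1 -> P n})
         (e : {linear P 0 -> M}),
    [/\ forall n, projective_module (P n),
        forall x, exists y, e y = x,
        exact_at (d 0) e,
        forall n, exact_at (d n.+1) (d n) &
        exists l, forall n, (l < n)%N -> forall x : P n, x = 0].

Definition finite_injdim M :=
  exists (E : nat -> lmodType R) (e : {linear M -> E 0})
         (d : forall n, {linear E n -> E n.+1}),
    [/\ forall n, injective_module (E n),
        injective e,
        exact_at e (d 0),
        forall n, exact_at (d n) (d n.+1) &
        exists l, forall n, (l < n)%N -> forall x : E n, x = 0].

Definition gorenstein := finite_injdim R^o.

(* A resolution of M by free modules of finite rank; matrices act on row
   vectors from the right. *)
Record free_resolution M := FreeResolution {
  fr_rank : nat -> nat;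
  fr_d : forall n, 'M[R]_(fr_rank n.+1, fr_rank n);
  fr_aug : {linear 'rV[R]_(fr_rank 0) -> M};
  fr_aug_surj : forall x, exists u, fr_aug u = x;
  fr_exact0 : exact_at (fun u : 'rV_(fr_rank 1) => u *m fr_d 0) fr_aug;
  fr_exact : forall n, exact_at (fun u : 'rV_(fr_rank n.+2) => u *m fr_d n.+1)
                                (fun u : 'rV_(fr_rank n.+1) => u *m fr_d n)
}.

(* D tensored with N, under the identification of R^p (x) N with N^p. *)
Definition tensor_map N p q (D : 'M[R]_(p, q)) (y : {ffun 'I_p -> N}) :
  {ffun 'I_q -> N} := [ffun j => \sum_(i < p) D i j *: y i].

(* H_i(F (x) N) = 0 *)
Definition tensor_homology_zero M (F : free_resolution M) N (i : nat) :=
  if i is j.+1 then exact_at (tensor_map (N := N) (fr_d F j.+1))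
                             (tensor_map (N := N) (fr_d F j))
  else forall y, exists x, tensor_map (N := N) (fr_d F 0) x = y.

Definition Tor_zero M N (i : nat) :=
  exists F : free_resolution M, tensor_homology_zero F N i.

Definition Tor_vanishing :=
  forall M N, finitely_generated M -> finitely_generated N ->
    (exists l, forall i, (l <= i)%N -> Tor_zero M N i) ->
    finite_projdim M \/ finite_projdim N.

End Modules.

Section FiberProduct.
Variables (k : fieldType) (S T : comNzRingType).
Variables (piS : {rmorphism S -> k}) (piT : {rmorphism T -> k}).

Definition fiber_pred : {pred S * T} := fun z => piS z.1 == piT z.2.

Lemma fiber_pred_subring : subring_closed fiber_pred.
Proof.
split=> [|x y /eqP hx /eqP hy|x y /eqP hx /eqP hy]; apply/eqP => /=.
- by rewrite !rmorph1.
- by rewrite !rmorphB hx hy.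
- by rewrite !rmorphM hx hy.
Qed.

HB.instance Definition _ :=
  GRing.isSubringClosed.Build (S * T)%type fiber_pred fiber_pred_subring.

Record fiber_product := FiberProduct {
  fiber_val :> S * T;
  fiber_valP : fiber_val \in fiber_pred
}.

HB.instance Definition _ := [isSub for fiber_val].
HB.instance Definition _ := [Choice of fiber_product by <:].
HB.instance Definition _ := [SubChoice_isSubComNzRing of fiber_product by <:].

Variables (s : S) (t : T).

(* The ideal of the fiber product generated by (s, -t). The product is taken
   in S * T, so no proof that (s, -t) lies in the fiber product is needed. *)
Definition connected_ideal : {pred fiber_product} :=
  fun z => `[< exists a : fiber_product, val z = val a * (s, - t) >].

Lemma connected_ideal_zmod : zmod_closed connected_ideal.
Proof.
split=> [|x y /asboolP[a ha] /asboolP[b hb]]; apply/asboolP.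
  by exists 0; rewrite !raddf0 mul0r.
by exists (a - b); rewrite !raddfB /= ha hb mulrBl.
Qed.

HB.instance Definition _ :=
  GRing.isZmodClosed.Build fiber_product connected_ideal connected_ideal_zmod.

Lemma connected_idealMl a x : x \in connected_ideal -> a * x \in connected_ideal.
Proof.
move=> /asboolP[b hb]; apply/asboolP; exists (a * b).
by rewrite !rmorphM /= hb mulrA.
Qed.

Definition connected_sum := Quotient.quot connected_ideal.

HB.instance Definition _ := GRing.Zmodule.on connected_sum.

Local Notation pi := (\pi_(Quotient.quot connected_ideal)).

(* The library has the ring structure only on quotients by proper ideals. *)
Definition csum_one : connected_sum := pi 1.
Definition csum_mul (x y : connected_sum) : connected_sum :=
  pi (repr x * repr y).

Lemma csum_piM x y : csum_mul (pi x) (pi y) = pi (x * y).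
Proof.
apply/eqP; rewrite /csum_mul -Quotient.idealrBE.
set x' := repr _; set y' := repr _.
have hx : x' - x \in connected_ideal.
  by rewrite Quotient.idealrBE reprK.
have hy : y' - y \in connected_ideal.
  by rewrite Quotient.idealrBE reprK.
have -> : x' * y' - x * y = x' * (y' - y) + y * (x' - x).
  by rewrite !mulrBr [y * x']mulrC [y * x]mulrC addrA subrK.
by rewrite rpredD // connected_idealMl.
Qed.

Lemma csum_piP (x : connected_sum) : exists a, x = pi a.
Proof. by exists (repr x); rewrite reprK. Qed.

Lemma csum_mulA : associative csum_mul.
Proof.
move=> x y z; have [a ->] := csum_piP x; have [b ->] := csum_piP y.
have [c ->] := csum_piP z.
by rewrite (csum_piM b c) (csum_piM a b) (csum_piM a (b * c)) mulrA csum_piM.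
Qed.

Lemma csum_mulC : commutative csum_mul.
Proof. by move=> x y; rewrite /csum_mul mulrC. Qed.

Lemma csum_mul1 : left_id csum_one csum_mul.
Proof. by move=> x; have [a ->] := csum_piP x; rewrite csum_piM mul1r. Qed.

Lemma csum_mulDl : left_distributive csum_mul +%R.
Proof.
move=> x y z; have [a ->] := csum_piP x; have [b ->] := csum_piP y.
have [c ->] := csum_piP z.
by rewrite (csum_piM a c) (csum_piM b c) -!raddfD (csum_piM (a + b) c) mulrDl.
Qed.

HB.instance Definition _ := GRing.Zmodule_isComPzRing.Build connected_sum
  csum_mulA csum_mulC csum_mul1 csum_mulDl.

End FiberProduct.

(* Graded-commutative DG algebra, graded by nat, with differential of degree
   -1; dg_comp n is the projection onto the component of degree n. *)
Record dg_algebra (R : comNzRingType) := DGAlgebra {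
  dg_alg :> algType R;
  dg_comp : nat -> {linear dg_alg -> dg_alg};
  dg_d : {linear dg_alg -> dg_alg};
  dg_comp_comp : forall i j a,
    dg_comp i (dg_comp j a) = if i == j then dg_comp j a else 0;
  dg_comp_sum : forall a, exists N, a = \sum_(i < N) dg_comp i a;
  dg_comp1 : dg_comp 0 1 = 1;
  dg_compM : forall i j a b, dg_comp i a = a -> dg_comp j b = b ->
    dg_comp (i + j) (a * b) = a * b;
  dg_mulC : forall i j a b, dg_comp i a = a -> dg_comp j b = b ->
    a * b = (-1) ^+ (i * j) * (b * a);
  dg_sqr0 : forall i a, odd i -> dg_comp i a = a -> a * a = 0;
  dg_d0 : forall a, dg_d (dg_comp 0 a) = 0;
  dg_dS : forall i a, dg_d (dg_comp i.+1 a) = dg_comp i (dg_d a);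
  dg_dd : forall a, dg_d (dg_d a) = 0;
  dg_leibniz : forall i a b, dg_comp i a = a ->
    dg_d (a * b) = dg_d a * b + (-1) ^+ i * (a * dg_d b)
}.

Section AcyclicClosure.
Variables (R : comNzRingType) (m : set R) (U : dg_algebra R).

(* The variables are x_i = g i 1 for i in X, of degree w i; for w i even, g i j
   is the j-th divided power of x_i (g i j is not used for w i odd, 1 < j). *)
Variables (X : set nat) (w : nat -> nat) (g : nat -> nat -> U).

Definition homogeneous (n : nat) (a : U) := dg_comp U n a = a.

Definition monomial N (mu : {ffun 'I_N -> nat}) : U := \prod_(i < N) g i (mu i).

(* Exponents of the normal monomials in the variables indexed by Y. *)
Definition exponent (Y : set nat) N (mu : {ffun 'I_N -> nat}) :=
  forall i, (0 < mu i)%N -> Y i /\ (odd (w i) -> mu i = 1%N).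

Definition monomial_span (Y : set nat) : set U :=
  [set a | exists N (s : seq {ffun 'I_N -> nat}) (c : {ffun 'I_N -> nat} -> R),
     (forall mu, mu \in s -> exponent Y mu) /\
     a = \sum_(mu <- s) c mu *: monomial mu].

(* R<X_{<= n}> *)
Definition trunc (n : nat) : set U :=
  monomial_span [set i | X i /\ (w i <= n)%N].

(* U is the free graded-commutative divided power algebra R<X>, with a
   differential compatible with divided powers. *)
Definition free_divided_powers :=
  [/\ forall i, g i 0 = 1,
      forall i, X i -> (0 < w i)%N /\ forall j, homogeneous (w i * j) (g i j),
      forall i, X i -> ~~ odd (w i) ->
        (forall j l, g i j * g i l = g i (j + l)%N *+ 'C(j + l, j)) /\
        (forall j, dg_d U (g i j.+1) = dg_d U (g i 1) * g i j),
      forall a : U, monomial_span X a &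
      forall N (s : seq {ffun 'I_N -> nat}) (c : {ffun 'I_N -> nat} -> R),
        uniq s -> (forall mu, mu \in s -> exponent X mu) ->
        \sum_(mu <- s) c mu *: monomial mu = 0 ->
        forall mu, mu \in s -> c mu = 0].

Definition vars (n : nat) : set nat := [set i | X i /\ w i = n].

(* The elements d(x_i), i in J, generate the maximal ideal. *)
Definition generate_max (J : set nat) :=
  forall r, m r -> exists (s : seq nat) (c : nat -> R),
    (forall i, i \in s -> J i) /\
    r%:A = \sum_(i <- s) c i *: dg_d U (g i 1).

(* The classes of the d(x_i), i in J, generate H_n(R<X_{<= n}>). *)
Definition generate_homology (n : nat) (J : set nat) :=
  forall z, trunc n z -> homogeneous n z -> dg_d U z = 0 ->
    exists (s : seq nat) (c : nat -> R) (b : U),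
      [/\ forall i, i \in s -> J i, trunc n b, homogeneous n.+1 b &
          z = \sum_(i <- s) c i *: dg_d U (g i 1) + dg_d U b].

Definition minimally (G : set nat -> Prop) (J : set nat) :=
  G J /\ forall i, J i -> ~ G (J `\ i).

Definition acyclic_closure :=
  [/\ free_divided_powers,
      forall i, vars 1 i -> exists2 r, m r & dg_d U (g i 1) = r%:A,
      minimally generate_max (vars 1),
      forall n i, (0 < n)%N -> vars n.+1 i -> trunc n (dg_d U (g i 1)) &
      forall n, (0 < n)%N -> minimally (generate_homology n) (vars n.+1)].

End AcyclicClosure.

Section Massey.
Variables (R : comNzRingType) (m : set R) (U : dg_algebra R).

(* The kernel of the augmentation U -> U_0 = R -> R/m. *)
Definition aug_ker : set U := [set a | exists2 r, m r & dg_comp U 0 a = r%:A].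

(* a |-> (-1)^(d+1) a for a of degree d, extended additively. *)
Definition dg_bar (a : U) : U :=
  \sum_(i \in [set: nat]) (-1) ^+ i.+1 *: dg_comp U i a.

(* A is (the underlying set of) a DG subalgebra of U. *)
Variable A : set U.

(* Homology classes are cosets of the boundaries d(A). *)
Definition homology_class (z : U) : set U :=
  [set y | exists2 b, A b & y = z + dg_d U b].

Definition reduced_homology : set (set U) :=
  [set v | exists z, [/\ A z, dg_d U z = 0, aug_ker z & v = homology_class z]].

Definition trivial_Massey :=
  exists gamma : seq (set U) -> U,
    [/\ forall v, v <> [::] -> (forall h, h \in v -> reduced_homology h) ->
          A (gamma v) /\ aug_ker (gamma v),
        forall h, reduced_homology h ->
          dg_d U (gamma [:: h]) = 0 /\ homology_class (gamma [:: h]) = h &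
        forall v, v <> [::] -> (forall h, h \in v -> reduced_homology h) ->
          dg_d U (gamma v) =
            \sum_(1 <= j < size v) dg_bar (gamma (take j v)) * gamma (drop j v)].

End Massey.

Definition generalized_Golod_level (R : comNzRingType) (m : set R) (q : nat) :=
  (0 < q)%N /\
  exists (U : dg_algebra R) (X : set nat) (w : nat -> nat) (g : nat -> nat -> U),
    acyclic_closure m X w g /\ trivial_Massey m (trunc X w g q).

Definition generalized_Golod (R : comNzRingType) (m : set R) :=
  exists q, generalized_Golod_level m q.

(* Main.v *)
(* Let R = S # T, and let I and J be the images of the maximal ideals of S and
   T: then I + J is the maximal ideal of R, IJ = 0, and the intersection of I
   and J is the socle (sigma).  In a minimal free resolution (F, d) say that the
   i-th syzygy has type I (type J) if one of its minimal generators d v has all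
   its coordinates in I (in J).

   - Type I at i gives type J at i + 1: since J dv = 0, the vectors r v with r
     in J are syzygies, and they cannot all be in m^2 F.  Likewise with I and J
     exchanged.
   - If Tor(M, N) vanishes in high degrees, a syzygy of M of type I and a high
     syzygy of N of type J cannot coexist: for the witnesses v and w, the
     element v (x) w is a nonzero minimal generator of a tensor product of
     syzygies, and is killed by the injection of this tensor product into
     F (x) (syzygy of N).
   So either M has no types at all, or all high syzygies of N have no type.

   - A resolution without types in high degrees is eventually zero.  Write
     d = delta + eps with entries in I and J.  As d^2 = 0, delta^2 = sigma E for
     a matrix E over k, which is injective when there are no types; hence the
     ranks are eventually 2-periodic and E is invertible.  As S has embedding
     dimension at least 2, there are c, x, x' in I with c I in (sigma),
     c x = sigma, c x' = 0 and x' not in m^2.  For a basis vector v one finds f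
     with c v = delta f, then e = E^-1 v and g, g' in I F with
     x f = delta e + d g and x' f = d g'.  Comparing x' (x f) with x (x' f)
     shows that x' e + x' g - x g' is a cycle, hence in m^2 F; so x' e is in
     m^2 F although e has a unit coordinate, a contradiction. *)

From HB Require Import structures.
Require Import Defs.
From mathcomp Require Import all_boot all_order all_algebra.
From mathcomp Require Import all_classical.

Set Implicit Arguments.
Unset Strict Implicit.
Unset Printing Implicit Defensive.

Import GRing.Theory.

Local Open Scope classical_set_scope.
Local Open Scope ring_scope.

(** * Balance of Tor and dimension shifting *)

Section TorSymmetry.
Variable R : comPzRingType.
Implicit Types M N : lmodType R.

Lemma fr_dd M (F : free_resolution M) n : fr_d F n.+1 *m fr_d F n = 0.
Proof.
apply/row_matrixP => i; rewrite row_mul row0.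
by apply/(@fr_exact _ _ F n); exists (delta_mx 0 i); rewrite -rowE.
Qed.

Lemma fr_aug_d M (F : free_resolution M) (u : 'rV_(fr_rank F 1)) :
  fr_aug F (u *m fr_d F 0) = 0.
Proof. by apply/(@fr_exact0 _ _ F); exists u. Qed.

Lemma fr_exactP M (F : free_resolution M) n q (Y : 'M_(q, fr_rank F n.+1)) :
  Y *m fr_d F n = 0 -> exists Z, Y = Z *m fr_d F n.+1.
Proof.
move=> Y0.
have /choice[z hz] : forall i, exists u, u *m fr_d F n.+1 = row i Y.
  by move=> i; apply/(@fr_exact _ _ F n); rewrite -row_mul Y0 row0.
exists (\matrix_i z i); apply/row_matrixP => i.
by rewrite row_mul rowK hz.
Qed.

(* H_{i+1}(F (x) N_j) = 0, where N_j is the cokernel of the map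
   G_{j+1} -> G_j: the rows of an element of F (x) G are indexed by F and the
   columns by G. *)
Definition tor_exact M N (F : free_resolution M) (G : free_resolution N) i j :=
  forall (Y : 'M_(fr_rank F i.+1, fr_rank G j)) Z,
    (fr_d F i)^T *m Y = Z *m fr_d G j ->
    exists A B, Y = (fr_d F i.+1)^T *m A + B *m fr_d G j.

(** A chase in the double complex: Y d_j is killed by d_i^T, so it equals d_{i+1}^T A, and A is a
    cycle for (i + 1, j). Writing A as a boundary plus B d_j, the difference Y - d_{i+1}^T B is
    killed by d_j and exactness of G applies. *)
Lemma tor_exact_shift M N (F : free_resolution M) (G : free_resolution N) i j :
  tor_exact F G i.+1 j -> tor_exact F G i j.+1.
Proof.
move=> h Y Z hY.
have : (Y *m fr_d G j)^T *m fr_d F i = 0.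
  by rewrite -[X in _ *m X]trmxK -trmx_mul mulmxA hY -mulmxA fr_dd mulmx0 trmx0.
case/fr_exactP => A /(congr1 trmx); rewrite trmxK trmx_mul => hA.
have [A' [B hB]] := h A^T Y (esym hA).
have : (Y - (fr_d F i.+1)^T *m B) *m fr_d G j = 0.
  rewrite mulmxBl hA hB mulmxDr !mulmxA -trmx_mul fr_dd trmx0 mul0mx add0r.
  by rewrite subrr.
case/fr_exactP => C hC; exists B, C.
by rewrite -hC addrC subrK.
Qed.

(** The augmentation of G, applied to rows, presents N as the cokernel of G_1 -> G_0; elements of F
    (x) N are lifted to F (x) G_0. *)
Lemma tor_exact0 M N (F : free_resolution M) (G : free_resolution N) i :
  tensor_homology_zero F N i.+1 -> tor_exact F G i 0.
Proof.
move=> h Y Z hY.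
pose y := [ffun a => fr_aug G (row a Y)].
have augE p q (D : 'M[R]_(p, q)) (W : 'M_(p, fr_rank G 0)) b :
  tensor_map D [ffun a => fr_aug G (row a W)] b = fr_aug G (row b (D^T *m W)).
  rewrite ffunE row_mul mulmx_sum_row linear_sum; apply: eq_bigr => a _.
  by rewrite ffunE linearZ !mxE.
have : tensor_map (fr_d F i) y = 0.
  by apply/ffunP => b; rewrite augE hY row_mul fr_aug_d ffunE.
case/h => x hx.
have /choice[a ha] : forall b, exists u, fr_aug G u = x b.
  by move=> b; apply: fr_aug_surj.
pose A := \matrix_b a b.
have xE : x = [ffun b => fr_aug G (row b A)].
  by apply/ffunP => b; rewrite ffunE rowK ha.
have /choice[b hb] : forall c, exists u, u *m fr_d G 0 =
    row c (Y - (fr_d F i.+1)^T *m A).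
  move=> c; apply/(@fr_exact0 _ _ G).
  have := congr1 (fun f : {ffun _ -> N} => f c) hx.
  by rewrite xE augE ffunE !linearB /= => ->; rewrite subrr.
exists A, (\matrix_c b c).
suff -> : (\matrix_c b c) *m fr_d G 0 = Y - (fr_d F i.+1)^T *m A.
  by rewrite addrC subrK.
by apply/row_matrixP => c; rewrite row_mul rowK hb.
Qed.

(** The edge i = 0 of the double complex: M is the cokernel of F_1 -> F_0, so a cycle of G (x) M
    lifts to a matrix Y to which the hypothesis applies. *)
Lemma tor_exact_balance M N (F : free_resolution M) (G : free_resolution N) j :
  tor_exact F G 0 j -> tensor_homology_zero G M j.+1.
Proof.
move=> h y.
have augE p q (D : 'M[R]_(p, q)) (W : 'M_(fr_rank F 0, p)) b :
  tensor_map D [ffun a => fr_aug F (col a W)^T] b = fr_aug F (col b (W *m D))^T.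
  rewrite ffunE; suff -> : (col b (W *m D))^T = \sum_i D i b *: (col i W)^T.
    by rewrite linear_sum; apply: eq_bigr => a _; rewrite ffunE linearZ.
  apply/rowP => a; rewrite summxE !mxE; apply: eq_bigr => c _.
  by rewrite !mxE mulrC.
have lift p (x : {ffun 'I_p -> M}) :
  exists W : 'M_(fr_rank F 0, p), x = [ffun a => fr_aug F (col a W)^T].
  have /choice[a ha] : forall b, exists u, fr_aug F u = x b.
    by move=> b; apply: fr_aug_surj.
  exists (\matrix_b a b)^T; apply/ffunP => b.
  by rewrite ffunE -tr_row trmxK rowK ha.
split=> [hy | [x <-]]; last first.
  have [X ->] := lift _ x; apply/ffunP => b.
  have -> : tensor_map (fr_d G j.+1) [ffun a => fr_aug F (col a X)^T]
            = [ffun a => fr_aug F (col a (X *m fr_d G j.+1))^T].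
    by apply/ffunP => c; rewrite augE ffunE.
  by rewrite augE -mulmxA fr_dd mulmx0 col0 trmx0 linear0 ffunE.
have [Y yE] := lift _ y.
have /choice[z hz] : forall b, exists u, u *m fr_d F 0 = (col b (Y *m fr_d G j))^T.
  by move=> b; apply/(@fr_exact0 _ _ F); rewrite -augE -yE hy ffunE.
have hZ : (fr_d F 0)^T *m (\matrix_b z b)^T = Y *m fr_d G j.
  apply: trmx_inj; rewrite -trmx_mul trmxK; apply/row_matrixP => b.
  by rewrite row_mul rowK hz tr_col.
have [A [B hB]] := h _ _ hZ.
have : (Y - (fr_d F 0)^T *m B) *m fr_d G j = 0.
  by rewrite mulmxBl -hZ hB mulmxDr !mulmxA -trmx_mul fr_dd trmx0 mul0mx add0r subrr.
case/fr_exactP => C /(canRL (subrK _)) YE.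
exists [ffun a => fr_aug F (col a C)^T]; apply/ffunP => b.
rewrite augE yE ffunE YE linearD !linearD /=.
suff -> : (col b ((fr_d F 0)^T *m B))^T = (col b B)^T *m fr_d F 0.
  by rewrite fr_aug_d addr0.
by rewrite tr_col trmx_mul trmxK row_mul tr_col.
Qed.

(** [Tor_zero] supplies only some resolution F' of M. Balancing passes to G (x) M, where F' no
    longer occurs, and balancing back reaches the prescribed F. The index is that of Tor_{i+1}(M,
    N_j) = Tor_{i+j+1}(M, N). *)
Lemma Tor_zero_exact M N (F : free_resolution M) (G : free_resolution N) i j :
  Tor_zero M N (i + j).+1 -> tor_exact F G i j.
Proof.
have down M' N' (F' : free_resolution M') (G' : free_resolution N') n :
    tor_exact F' G' n 0 -> forall a b, (a + b)%N = n -> tor_exact F' G' a b.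
  move=> h a b; elim: b a => [|b IHb] a; first by rewrite addn0 => ->.
  by rewrite -addSnnS => /IHb; apply: tor_exact_shift.
case=> F' /(@tor_exact0 _ _ F' G)/down/(_ 0 _ erefl)/tor_exact_balance.
move=> /(@tor_exact0 _ _ G F)/down/(_ 0 _ erefl)/tor_exact_balance.
by move=> /(@tor_exact0 _ _ F G)/down; apply.
Qed.

End TorSymmetry.

(** * Concatenation of two finite families *)

Section JoinOrd.
Variables (A : Type) (p q : nat) (f : 'I_p -> A) (g : 'I_q -> A).

Definition join_ord (i : 'I_(p + q)) :=
  match fintype.split i with inl a => f a | inr b => g b end.

Lemma join_ordl i : join_ord (lshift q i) = f i.
Proof. by rewrite /join_ord -/(unsplit (inl i)) unsplitK. Qed.

Lemma join_ordr i : join_ord (rshift p i) = g i.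
Proof. by rewrite /join_ord -/(unsplit (inr i)) unsplitK. Qed.

End JoinOrd.

(** * Minimal free resolutions over a Noetherian local ring *)

Section MinimalResolution.
Variables (k : fieldType) (R : comPzRingType) (rho : {rmorphism R -> k}).
Hypothesis rho_unit : forall x, rho x != 0 -> exists y, x * y = 1.

Definition combination (V : lmodType R) p (g : 'I_p -> V) (u : 'rV[R]_p) : V :=
  \sum_i u 0 i *: g i.

Lemma combination_linear (V : lmodType R) p (g : 'I_p -> V) :
  linear (combination g).
Proof.
move=> a u v; rewrite /combination scaler_sumr -big_split; apply: eq_bigr => i _.
by rewrite !mxE scalerDl scalerA.
Qed.

HB.instance Definition _ (V : lmodType R) p (g : 'I_p -> V) :=
  GRing.isLinear.Build R 'rV[R]_p V _ (combination g) (combination_linear g).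

Definition spanned (V : lmodType R) (K : V -> Prop) p (g : 'I_p -> V) :=
  forall x, K x <-> exists u, x = combination g u.

Lemma minimal_spanned (V : lmodType R) (K : V -> Prop) :
  (exists p (g : 'I_p -> V), spanned K g) ->
  exists p (g : 'I_p -> V), spanned K g /\
    forall u, combination g u = 0 -> map_mx rho u = 0.
Proof.
move=> Kfg.
have exP : exists p, `[< exists g : 'I_p -> V, spanned K g >].
  by case: Kfg => p Kp; exists p; apply/asboolP.
case: (ex_minnP exP) => p /asboolP[g Kg] pmin; exists p, g; split=> // u gu0.
apply/rowP => i; rewrite !mxE; apply/eqP/contraT => /rho_unit[y uy].
case: p => [|p] in g Kg pmin u gu0 i y uy *; first by case: i uy.
suff : (p.+1 <= p)%N by rewrite ltnn.
apply: pmin; apply/asboolP; exists (fun j => g (lift i j)) => x.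
split=> [/Kg[v ->] | [v ->]].
  (* Subtracting this multiple of the relation u makes coordinate i vanish. *)
  exists (\row_j (v - (v 0 i * y) *: u) 0 (lift i j)).
  transitivity (combination g (v - (v 0 i * y) *: u)).
    by rewrite linearB linearZ /= gu0 scaler0 subr0.
  rewrite [LHS](bigD1_ord i) //= !mxE -mulrA [y * _]mulrC uy mulr1 subrr scale0r.
  by rewrite add0r; apply: eq_bigr => j _; rewrite !mxE.
apply/Kg; exists (\row_j if unlift i j is Some l then v 0 l else 0).
rewrite [RHS](bigD1_ord i) //= !mxE unlift_none scale0r add0r.
by apply: eq_bigr => j _; rewrite mxE liftK.
Qed.

(** [noetherian] restated over [comPzRingType], the structure carried by [connected_sum], with
    finite families in place of sequences. *)
Definition ideal_fg := forall K : R -> Prop,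
  K 0 -> (forall x y, K x -> K y -> K (x + y)) -> (forall a x, K x -> K (a * x)) ->
  exists p (g : 'I_p -> R),
    forall x, K x <-> exists u : 'I_p -> R, x = \sum_i u i * g i.

Definition submodule (V : lmodType R) (K : V -> Prop) :=
  [/\ K 0, forall x y, K x -> K y -> K (x + y) & forall a x, K x -> K (a *: x)].

(** Induction on n: the first coordinates of K form an ideal, and the vectors of K with first
    coordinate 0 form a submodule of R^n. Lifts of generators of the former and generators of the
    latter together generate K. *)
Lemma submodule_rV_fg n (K : 'rV[R]_n -> Prop) :
  ideal_fg -> submodule K -> exists p (g : 'I_p -> 'rV[R]_n), spanned K g.
Proof.
move=> Rnoeth; elim: n K => [|n IHn] K [K0 KD KZ].
  exists 0, (fun=> 0) => x; split=> [_|_]; last by rewrite [x]thinmx0.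
  by exists 0; rewrite [RHS]thinmx0 [x]thinmx0.
pose lead x := exists2 u, K u & u 0 ord0 = x.
have [|x y [u Ku <-] [v Kv <-]|a x [u Ku <-]|p [g gP]] := Rnoeth lead.
- by exists 0; rewrite ?mxE.
- by exists (u + v); [apply: KD | rewrite mxE].
- by exists (a *: u); [apply: KZ | rewrite mxE].
pose tail (u : 'rV[R]_n) := K (row_mx 0 u : 'rV_(1 + n)).
have [|q [h hP]] := IHn tail.
  split=> [|x y Kx Ky|a x Kx]; rewrite /tail.
  - by rewrite row_mx0.
  - by rewrite -[X in row_mx X _](addr0 0) -add_row_mx; apply: KD.
  - by rewrite -[X in row_mx X _](scaler0 _ a) -scale_row_mx; apply: KZ.
have /choice[G GP] : forall i, exists u, K u /\ u 0 ord0 = g i.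
  move=> i; have /gP[u Ku <-] : exists u, g i = \sum_j u j * g j; last by exists u.
  exists (fun j => (j == i)%:R); rewrite (bigD1 i) //= eqxx mul1r.
  by rewrite big1 ?addr0 // => j /negbTE->; rewrite mul0r.
have combK r (f : 'I_r -> 'rV[R]_n.+1) u :
    (forall i, K (f i)) -> K (combination f u).
  by move=> Kf; apply: (big_ind K) => // i _; apply: KZ.
have hK i : tail (h i).
  apply/hP; exists (delta_mx 0 i).
  rewrite /combination (bigD1 i) //= mxE !eqxx scale1r.
  by rewrite big1 ?addr0 // => j ji; rewrite mxE (negbTE ji) andbF scale0r.
pose H i : 'rV_n.+1 := row_mx (0 : 'rV_1) (h i).
exists (p + q)%N, (join_ord G H).
have combE (a : 'rV_p) (b : 'rV_q) : combination (join_ord G H) (row_mx a b)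
    = combination G a + combination H b.
  rewrite /combination big_split_ord; congr (_ + _); apply: eq_bigr => i _.
    by rewrite row_mxEl join_ordl.
  by rewrite row_mxEr join_ordr.
move=> x; split=> [Kx | [u ->]]; last first.
  rewrite -[u]hsubmxK combE; apply: KD; apply: combK => // i.
  by case: (GP i).
have /gP[c ha] : lead (x 0 ord0) by exists x.
pose a := \row_i c i.
pose y := x - combination G a.
have y0 : y 0 ord0 = 0.
  rewrite !mxE ha /combination summxE; apply/eqP; rewrite subr_eq0; apply/eqP.
  by apply: eq_bigr => i _; rewrite !mxE (GP i).2.
have yE : y = row_mx (0 : 'rV_1) (rsubmx (y : 'rV_(1 + n))).
  apply: etrans (esym (@hsubmxK _ 1 1 n y)) _; congr (row_mx _ _); apply/rowP => i.
  rewrite ord1 [RHS]mxE -y0 mxE /y; congr (fun_of_matrix _ _ _).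
  exact: val_inj.
have /hP[b hb] : tail (rsubmx (y : 'rV_(1 + n))).
  rewrite /tail -yE /y -scaleN1r; apply: KD => //; apply: KZ; apply: combK => i.
  by case: (GP i).
exists (row_mx a b); rewrite combE -[LHS](subrK (combination G a)) addrC.
congr (_ + _); rewrite -/y yE hb.
apply: (big_rec2 (fun (u : 'rV_n) (v : 'rV_(1 + n)) => row_mx (0 : 'rV_1) u = v)).
  by rewrite row_mx0.
move=> i u v _ <-; rewrite -[X in row_mx X _ = _](addr0 0) -add_row_mx.
congr (_ + _); rewrite -[X in row_mx X _ = _](scaler0 _ (b 0 i)).
by rewrite -scale_row_mx.
Qed.

Definition minimal_resolution (M : lmodType R) (F : free_resolution M) :=
  forall n, map_mx rho (fr_d F n) = 0.

Lemma combination_row p n (D : 'M[R]_(p, n)) u :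
  combination (fun i => row i D) u = u *m D.
Proof. by rewrite mulmx_sum_row. Qed.

Lemma minimal_matrix n (K : 'rV[R]_n -> Prop) : ideal_fg -> submodule K ->
  exists p (D : 'M[R]_(p, n)), (forall x, K x <-> exists u, u *m D = x) /\
    forall u : 'rV_p, u *m D = 0 -> map_mx rho u = 0.
Proof.
move=> Rnoeth /(submodule_rV_fg Rnoeth)/minimal_spanned[p [g [gP gmin]]].
have gE u : combination g u = u *m \matrix_i g i.
  by rewrite -combination_row; apply: eq_bigr => i _; rewrite rowK.
exists p, (\matrix_i g i); split=> [x|u]; last by rewrite -gE; apply: gmin.
split=> [/gP[u ->]|[u <-]]; first by exists u; rewrite gE.
by apply/gP; exists u; rewrite gE.
Qed.

Lemma ker_submodule (V W : lmodType R) (f : {linear V -> W}) :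
  submodule (fun u => f u = 0).
Proof.
split=> [|x y fx fy|a x fx]; first exact: linear0.
  by rewrite linearD fx fy addr0.
by rewrite linearZ_LR fx scaler0.
Qed.

Lemma minimal_resolution_exists (M : lmodType R) :
  ideal_fg -> finitely_generated M ->
  exists F : free_resolution M, minimal_resolution F.
Proof.
move=> Rnoeth [n [g0 hg0]].
have [|r0 [g [gP gmin]]] := @minimal_spanned M (fun=> True).
  exists n, g0 => x; split=> // _; have [c ->] := hg0 x.
  by exists (\row_i c i); apply: eq_bigr => i _; rewrite mxE.
have [p0 [D0 [D0P D0min]]] := minimal_matrix Rnoeth (ker_submodule (combination g)).
(* A state bundles a matrix with both its sizes, so that the next syzygy matrix, whose number of
   columns is only known then, can be chosen by recursion. *)
pose state := {q : nat & {p : nat & 'M[R]_(p, q)}}.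
have ex (s : state) : exists pD : {p : nat & 'M[R]_(p, projT1 (projT2 s))},
    (forall x : 'rV_(projT1 (projT2 s)),
       x *m projT2 (projT2 s) = 0 <-> exists u, u *m projT2 pD = x) /\
    forall u : 'rV_(projT1 pD), u *m projT2 pD = 0 -> map_mx rho u = 0.
  case: s => [q [p D]]; have [p' [D' D'P]] :=
    minimal_matrix Rnoeth (ker_submodule (@mulmxr R 1 p q D)).
  by exists (existT _ p' D').
pose next s := projT1 (cid (ex s)); have nextP s := projT2 (cid (ex s)).
pose st := fix st i : state := if i is j.+1
  then existT _ (projT1 (projT2 (st j))) (next (st j))
  else existT _ r0 (existT _ p0 D0).
pose rk i := projT1 (st i).
pose d i : 'M[R]_(rk i.+1, rk i) := projT2 (projT2 (st i)).
pose F := @FreeResolution R M rk d (combination g).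
have ex0 : exact_at (fun u : 'rV_(rk 1) => u *m d 0) (combination g) by exact: D0P.
have exS i : exact_at (fun u : 'rV_(rk i.+2) => u *m d i.+1)
                      (fun u : 'rV_(rk i.+1) => u *m d i).
  by case: (nextP (st i)).
have surj x : exists u, combination g u = x.
  by have [/(_ I)[u ->] _] := gP x; exists u.
exists (F surj ex0 exS) => i /=.
(* Each row of d_i is a relation among the generators chosen one step earlier, which were chosen
   minimal. *)
apply/row_matrixP => a; rewrite row0 -map_row.
case: i a => [|i] a.
  by apply: gmin; apply/D0P; exists (delta_mx 0 a); rewrite -rowE.
case: i a => [|i] a.
  by apply: D0min; apply/(exS 0); exists (delta_mx 0 a); rewrite -rowE.
apply: (nextP (st i)).2.
by apply/(exS i.+1); exists (delta_mx 0 a); rewrite -rowE.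
Qed.

End MinimalResolution.

(** * Local rings whose maximal ideal is a sum I + J with IJ = 0 *)

Section DecomposedMaximalIdeal.
Variables (k : fieldType) (R : comPzRingType) (rho : {rmorphism R -> k}).
Variables (I J Q : set R) (sigma : R).

Definition ideal_closed (K : set R) :=
  [/\ K 0, forall x y, K x -> K y -> K (x + y) & forall a x, K x -> K (a * x)].

Definition entries (K : set R) p q (A : 'M[R]_(p, q)) := forall i j, K (A i j).

(* ker rho is the maximal ideal m of R; Q stands for m^2, and any ideal that
   contains m^2 but neither I nor J will do. *)
Definition decomposed :=
  [/\ [/\ forall a, exists x, rho x = a,
          forall x, rho x != 0 -> exists y, x * y = 1 &
          forall x, rho x = 0 -> exists a b, [/\ I a, J b & x = a + b]],
      [/\ ideal_closed I, ideal_closed J & ideal_closed Q],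
      [/\ forall x, I x -> rho x = 0,
          forall x, J x -> rho x = 0,
          forall x y, I x -> J y -> x * y = 0 &
          forall x y, rho x = 0 -> rho y = 0 -> Q (x * y)],
      [/\ I sigma, J sigma, sigma != 0 &
          forall x, I x -> J x -> exists r, x = r * sigma] &
      (exists2 x, I x & ~ Q x) /\ (exists2 y, J y & ~ Q y)].

End DecomposedMaximalIdeal.

Section ClosedEntries.
Variables (R : comPzRingType) (K : set R).
Hypothesis idK : ideal_closed K.

Lemma ideal_sum T (r : seq T) (P : pred T) (f : T -> R) :
  (forall i, P i -> K (f i)) -> K (\sum_(i <- r | P i) f i).
Proof. by case: idK => K0 KD _ Kf; apply: (big_ind K). Qed.

Lemma entriesD p q (A B : 'M_(p, q)) :
  entries K A -> entries K B -> entries K (A + B).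
Proof. by case: idK => _ KD _ hA hB i j; rewrite mxE; apply: KD. Qed.

Lemma entriesZ a p q (A : 'M_(p, q)) : entries K A -> entries K (a *: A).
Proof. by case: idK => _ _ KM hA i j; rewrite mxE; apply: KM. Qed.

Lemma entriesN p q (A : 'M_(p, q)) : entries K A -> entries K (- A).
Proof. by rewrite -scaleN1r; apply: entriesZ. Qed.

Lemma entriesMl p q r (A : 'M_(p, q)) (B : 'M_(q, r)) :
  entries K B -> entries K (A *m B).
Proof.
case: idK => _ _ KM hB i j; rewrite mxE; apply: ideal_sum => l _.
exact: KM.
Qed.

Lemma entriesMr p q r (A : 'M_(p, q)) (B : 'M_(q, r)) :
  entries K A -> entries K (A *m B).
Proof.
case: idK => _ _ KM hA i j; rewrite mxE; apply: ideal_sum => l _.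
by rewrite mulrC; apply: KM.
Qed.

End ClosedEntries.

(** * Types of syzygies *)

Section Types.
Variables (k : fieldType) (R : comPzRingType) (rho : {rmorphism R -> k}).
Variables (I J Q : set R) (sigma : R).
Hypothesis dec : decomposed rho I J Q sigma.

Lemma decomposedC : decomposed rho J I Q sigma.
Proof.
case: dec => [[h1 h2 h3] [h4 h5 h6] [h7 h8 h9 h10] [h11 h12 h13 h14] [h15 h16]].
split; split=> //.
- by move=> x /h3[a [b [Ia Jb ->]]]; exists b, a; rewrite addrC.
- by move=> x y Jx Iy; rewrite mulrC h9.
- by move=> x Jx Ix; apply: h14.
Qed.

Lemma rho_lift p q (A : 'M[k]_(p, q)) : exists B : 'M[R]_(p, q), map_mx rho B = A.
Proof.
case: dec => [[surj _ _] _ _ _ _].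
have /choice[l hl] := surj.
by exists (map_mx l A); apply/matrixP => i j; rewrite !mxE hl.
Qed.

Lemma rho_split p q (A : 'M[R]_(p, q)) : map_mx rho A = 0 ->
  exists B C, [/\ entries I B, entries J C & A = B + C].
Proof.
case: dec => [[_ _ spl] _ _ _ _] A0.
have /choice[b hb] (ij : 'I_p * 'I_q) : exists bc : R * R,
    [/\ I bc.1, J bc.2 & A ij.1 ij.2 = bc.1 + bc.2].
  have /spl[b [c [Ib Jc E]]] : rho (A ij.1 ij.2) = 0.
    by have := congr1 (fun B : 'M_(p, q) => B ij.1 ij.2) A0; rewrite !mxE.
  by exists (b, c).
exists (\matrix_(i, j) (b (i, j)).1), (\matrix_(i, j) (b (i, j)).2).
split=> [i j|i j|]; rewrite ?mxE; try by case: (hb (i, j)).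
by apply/matrixP => i j; rewrite !mxE; case: (hb (i, j)).
Qed.

Lemma entries_rho p q (A : 'M[R]_(p, q)) : entries I A -> map_mx rho A = 0.
Proof.
case: dec => _ _ [Irho _ _ _] _ _ IA.
by apply/matrixP => i j; rewrite !mxE Irho.
Qed.

Lemma entries_mul0 p q r (A : 'M[R]_(p, q)) (B : 'M_(q, r)) :
  entries I A -> entries J B -> A *m B = 0.
Proof.
case: dec => _ _ [_ _ IJ0 _] _ _ IA JB.
by apply/matrixP => i j; rewrite !mxE big1 // => l _; rewrite IJ0.
Qed.

Lemma entries_cap p q (A : 'M[R]_(p, q)) :
  entries I A -> entries J A -> exists B, A = sigma *: B.
Proof.
case: dec => _ _ _ [_ _ _ cap] _ IA JA.
have /choice[b hb] (ij : 'I_p * 'I_q) : exists b, A ij.1 ij.2 = b * sigma.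
  exact: cap.
exists (\matrix_(i, j) b (i, j)); apply/matrixP => i j.
by rewrite !mxE (hb (i, j)) mulrC.
Qed.

Lemma sigma_mul0 x : rho x = 0 -> sigma * x = 0.
Proof.
case: dec => [[_ _ spl] _ [_ _ IJ0 _] [Is Js _ _] _].
move=> /spl[a [b [Ia Jb ->]]].
by rewrite mulrDr [sigma * a]mulrC !IJ0 ?addr0.
Qed.

(** The ideal generated by sigma is a copy of k: ker rho kills sigma and units do not. Equations
    over k can thus be read inside R. *)
Lemma sigma_scale p q (A B : 'M[R]_(p, q)) :
  sigma *: A = sigma *: B <-> map_mx rho A = map_mx rho B.
Proof.
have eq0 x : sigma * x = 0 <-> rho x = 0.
  split=> [s0|]; last exact: sigma_mul0.
  case: dec => [[_ unit _] _ _ [_ _ /eqP sn0 _] _].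
  apply/eqP/contraT => /unit[y xy]; case: sn0.
  by rewrite -[sigma]mulr1 -xy mulrA s0 mul0r.
split=> E; apply/matrixP => i j; have := congr1 (fun C : 'M_(p, q) => C i j) E;
  rewrite !mxE => /eqP; rewrite -subr_eq0 -?mulrBr -?rmorphB.
  by move/eqP/eq0/eqP; rewrite rmorphB subr_eq0 => /eqP.
by move/eqP/eq0/eqP; rewrite mulrBr subr_eq0 => /eqP.
Qed.

Lemma sigma_scale0 p q (A : 'M[R]_(p, q)) :
  sigma *: A = 0 <-> map_mx rho A = 0.
Proof. by have := sigma_scale A 0; rewrite scaler0 map_mx0. Qed.

Variables (M : lmodType R) (F : free_resolution M).
Hypothesis minF : minimal_resolution rho F.

(* The image of d_i in F_i has a minimal generator with coordinates in K. *)
Definition type_at (K : set R) i :=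
  exists2 v : 'rV_(fr_rank F i.+1), map_mx rho v != 0 & entries K (v *m fr_d F i).

Lemma rho_neq0 p (v : 'rV[R]_p) : map_mx rho v != 0 ->
  exists i y, v 0 i * y = 1.
Proof.
move=> v0; have [i vi] : exists i, rho (v 0 i) != 0.
  apply/existsP; apply: contraNT v0 => /existsPn v0.
  by apply/eqP/rowP => i; rewrite !mxE; apply/eqP; rewrite -[_ == _]negbK v0.
by case: dec => [[_ /(_ _ vi)[y hy] _] _ _ _ _]; exists i, y.
Qed.

Lemma type_at_step i : type_at I i -> type_at J i.+1.
Proof.
case: dec => [_ [idI idJ idQ] [_ Jrho IJ0 QM] _ [_ [r Jr Qr]]].
case=> v /rho_neq0[l [y vy]] Iv; case: (pselect (type_at J i.+1)) => // notJ.
case: Qr.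
(* As r is in J and v d has entries in I, r v is a cycle z d. A unit entry of z would make z a
   witness of type J, since r v has entries in J. *)
have [|z hz] := @fr_exactP _ _ F i _ (r *: v).
  rewrite -scalemxAl; apply/matrixP => a b.
  by rewrite !mxE mulrC; apply: IJ0 => //; have := Iv a b; rewrite mxE.
have z0 : map_mx rho z = 0.
  apply/eqP/contraT => z0; case: notJ; exists z => //; rewrite -hz => a b.
  by rewrite mxE mulrC; case: idJ => _ _; apply.
(* Coordinate l of v is a unit, so r v having entries in Q would put r in Q. *)
have -> : r = y * (r *: v) 0 l by rewrite mxE mulrCA [y * _]mulrC vy mulr1.
case: (idQ) => _ _; apply; rewrite hz mxE; apply: (ideal_sum idQ) => a _.
apply: QM.
  by have := congr1 (fun A : 'rV_ _ => A 0 a) z0; rewrite !mxE.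
by have := congr1 (fun A : 'M_(_, _) => A a l) (minF i.+1); rewrite !mxE.
Qed.

End Types.

(** * Exclusion of opposite types by vanishing Tor *)

Section TypesOfModules.
Variables (k : fieldType) (R : comPzRingType) (rho : {rmorphism R -> k}).

(* If v and w witness the types, v^T w is a cycle of F (x) G modulo the
   next syzygy of G, since IJ = 0, but by minimality it is not a boundary. *)
Lemma tor_exact_types I J Q sigma (M N : lmodType R) (F : free_resolution M)
    (G : free_resolution N) i j :
  decomposed rho I J Q sigma -> minimal_resolution rho F -> minimal_resolution rho G ->
  tor_exact F G i j.+1 -> type_at rho F I i -> ~ type_at rho G J j.
Proof.
move=> dec minF minG exFG [v v0 Iv] [w w0 Jw].
have [Z hZ] : exists Z, (fr_d F i)^T *m (v^T *m w) = Z *m fr_d G j.+1.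
  suff /fr_exactP[Z ->] : (fr_d F i)^T *m (v^T *m w) *m fr_d G j = 0 by exists Z.
  rewrite mulmxA -trmx_mul -mulmxA (entries_mul0 dec) // => a b.
  by rewrite mxE; apply: Iv.
have [A [B /(congr1 (map_mx rho))]] := exFG _ _ hZ.
rewrite map_mxD !map_mxM -!map_trmx minF minG trmx0 mul0mx mulmx0 addr0 => vw0.
have [a [y vy]] := rho_neq0 dec v0; have [b [z wz]] := rho_neq0 dec w0.
have := congr1 (fun C : 'M_(_, _) => C a b * (rho y * rho z)) vw0.
rewrite !mxE mul0r big_ord1 !mxE -!rmorphM mulrACA vy wz mulr1 rmorph1.
by move/eqP; rewrite oner_eq0.
Qed.

Variables (I J Q : set R) (sigma c x x' : R).
Hypothesis dec : decomposed rho I J Q sigma.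
Hypothesis Ic : I c.
Hypothesis c_socle : forall a, I a -> exists r, c * a = r * sigma.
Hypotheses (Ix : I x) (cx : c * x = sigma).
Hypotheses (Ix' : I x') (cx' : c * x' = 0) (Qx' : ~ Q x').

Lemma nonincreasing_stationary (u : nat -> nat) n0 :
  (forall n, n0 <= n -> u n.+1 <= u n)%N ->
  exists2 n1, (n0 <= n1)%N & forall n, (n1 <= n)%N -> u n = u n1.
Proof.
have [b] := ubnP (u n0); elim: b n0 => // b IHb n0 ub un.
case: (pselect (exists2 n, (n0 <= n)%N & (u n < u n0)%N)) => [[n n0n unn0]|h].
  have [||n1 nn1 hn1] := IHb n; first by apply: leq_trans unn0 _.
    by move=> l nl; apply: un; apply: leq_trans nl.
  by exists n1 => //; apply: leq_trans nn1.
exists n0 => // n n0n; apply/eqP; rewrite eqn_leq; apply/andP; split.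
  elim: n n0n => [|n IHn]; first by rewrite leqn0 => /eqP->.
  by rewrite leq_eqVlt => /orP[/eqP->//|n0n]; apply: leq_trans (un _ _) (IHn _).
by rewrite leqNgt; apply/negP => lt; apply: h; exists n.
Qed.

(** * Minimal resolutions without types in high degrees *)

Section Typeless.
Variables (M : lmodType R) (F : free_resolution M) (n0 : nat).
Hypothesis minF : minimal_resolution rho F.
Hypothesis notypeI : forall n, (n0 <= n)%N -> ~ type_at rho F I n.
Hypothesis notypeJ : forall n, (n0 <= n)%N -> ~ type_at rho F J n.

Local Notation d := (fr_d F).
Local Notation rk := (fr_rank F).

Let idI : ideal_closed I. Proof. by case: dec => _ []. Qed.
Let idJ : ideal_closed J. Proof. by case: dec => _ []. Qed.
Let idQ : ideal_closed Q. Proof. by case: dec => _ []. Qed.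

Variables delta eps : forall n, 'M[R]_(rk n.+1, rk n).
Variable E : forall n, 'M[R]_(rk n.+2, rk n).
Hypothesis deltaI : forall n, entries I (delta n).
Hypothesis epsJ : forall n, entries J (eps n).
Hypothesis dE : forall n, d n = delta n + eps n.
Hypothesis delta2 : forall n, delta n.+1 *m delta n = sigma *: E n.

Lemma mul_entriesI q n (u : 'M_(q, _)) : entries I u -> u *m d n = u *m delta n.
Proof. by move=> Iu; rewrite dE mulmxDr (entries_mul0 dec Iu (@epsJ n)) addr0. Qed.

Lemma mul_entriesJ q n (u : 'M_(q, _)) : entries J u -> u *m d n = u *m eps n.
Proof.
by move=> Ju; rewrite dE mulmxDr (entries_mul0 (decomposedC dec) Ju (@deltaI n)) add0r.
Qed.

(** The mixed terms of d^2 = 0 vanish because IJ = 0, leaving delta^2 + eps^2 = 0. *)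
Lemma eps2 n : eps n.+1 *m eps n = - (sigma *: E n).
Proof.
apply/eqP; rewrite -addr_eq0 addrC; apply/eqP; rewrite -delta2 -(fr_dd F n).
rewrite [d n.+1]dE mulmxDl mul_entriesI; last exact: deltaI.
by rewrite mul_entriesJ.
Qed.

Lemma cycleI_rho n (u : 'rV_(rk n.+1)) : (n0 <= n)%N ->
  entries I (u *m d n) -> map_mx rho u = 0.
Proof.
move=> n0n Iu; apply/eqP/contraT => u0.
by case: (notypeI n0n); exists u.
Qed.

Lemma cycleJ_rho n (u : 'rV_(rk n.+1)) : (n0 <= n)%N ->
  entries J (u *m d n) -> map_mx rho u = 0.
Proof.
move=> n0n Ju; apply/eqP/contraT => u0.
by case: (notypeJ n0n); exists u.
Qed.

(** If v E = 0 over k, then v delta and v eps are both cycles, hence a d and b d. Absence of types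
    puts a and b in m F. Since v - (a + b) is a cycle, it is in m F by minimality, and so is v. *)
Lemma E_row_free n : (n0 <= n)%N -> row_free (map_mx rho (E n)).
Proof.
move=> n0n; apply: inj_row_free => v0 vE.
have [v vv0] := rho_lift dec v0; rewrite -{}vv0 in vE *.
have vE0 : sigma *: (v *m E n) = 0 by apply/(sigma_scale0 dec); rewrite map_mxM.
have Iv : entries I (v *m delta n.+1) by apply: entriesMl.
have Jv : entries J (v *m eps n.+1) by apply: entriesMl.
have [|a ha] := @fr_exactP _ _ F n _ (v *m delta n.+1).
  by rewrite mul_entriesI // -mulmxA delta2 -scalemxAr.
have [|b hb] := @fr_exactP _ _ F n _ (v *m eps n.+1).
  by rewrite mul_entriesJ // -mulmxA eps2 mulmxN -scalemxAr vE0 oppr0.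
have a0 : map_mx rho a = 0 by apply: (@cycleI_rho n.+1); rewrite ?leqW // -ha.
have b0 : map_mx rho b = 0 by apply: (@cycleJ_rho n.+1); rewrite ?leqW // -hb.
have [|e he] := @fr_exactP _ _ F n.+1 _ (v - (a + b)).
  by rewrite mulmxBl mulmxDl -ha -hb -mulmxDr -dE subrr.
have := congr1 (map_mx rho) he.
by rewrite map_mxM minF mulmx0 map_mxB map_mxD a0 b0 addr0 subr0.
Qed.

Lemma rank_le n : (n0 <= n)%N -> (rk n.+2 <= rk n)%N.
Proof. by move=> /E_row_free/eqP <-; apply: rank_leq_col. Qed.

Variable n1 : nat.
Hypothesis n01 : (n0 <= n1)%N.
Hypothesis rank_eq : forall n, (n1 <= n)%N -> rk n.+2 = rk n.

(** Equal ranks make the row-free [E n] invertible over k, and sigma sees only residues. *)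
Lemma E_surj n (v : 'rV_(rk n)) : (n1 <= n)%N ->
  exists e, e *m delta n.+1 *m delta n = sigma *: v.
Proof.
move=> n1n.
have Efull : row_full (map_mx rho (E n)).
  have := E_row_free (leq_trans n01 n1n).
  by rewrite /row_free /row_full => /eqP->; rewrite rank_eq.
have /submxP[e0 ee0] := submx_full (map_mx rho v) Efull.
have [e ee] := rho_lift dec e0; exists e.
rewrite -mulmxA delta2 -scalemxAr; apply/(sigma_scale dec).
by rewrite map_mxM ee ee0.
Qed.

(** Write z = w d. Absence of type I gives w = a + b with entries in I and J. Then b d has entries
    in both I and J, so it is sigma u, and [E_surj] replaces b by some e delta with entries in I. *)
Lemma cycleI_boundary n (z : 'rV_(rk n.+1)) : (n1 <= n)%N ->
  entries I z -> z *m d n = 0 -> exists2 g, entries I g & z = g *m d n.+1.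
Proof.
move=> n1n Iz /fr_exactP[w zw]; have n0n := leq_trans n01 n1n.
have w0 : map_mx rho w = 0 by apply: (@cycleI_rho n.+1); rewrite ?leqW // -zw.
have [a [b [Ia Jb wE]]] := rho_split dec w0.
have [||u hu] := @entries_cap _ _ _ _ _ _ _ dec _ _ (b *m d n.+1).
- have -> : b *m d n.+1 = z - a *m d n.+1 by rewrite zw wE mulmxDl addrAC subrr add0r.
  by apply: entriesD => //; apply: entriesN => //; apply: entriesMr.
- exact: entriesMr.
have [e he] := E_surj u (leqW n1n).
exists (a + e *m delta n.+2); first by apply: entriesD => //; apply: entriesMl.
rewrite mulmxDl [e *m _ *m d _]mul_entriesI; last exact: entriesMl.
by rewrite he -hu -mulmxDl -wE.
Qed.

Lemma typeless_rank0 : rk n1.+1 = 0.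
Proof.
case: dec => [_ _ [Irho _ _ _] [_ _ /eqP sn0 _] _].
apply/eqP; rewrite -leqn0 leqNgt; apply/negP => r_gt0.
pose i0 := Ordinal r_gt0; pose v : 'rV[R]_(rk n1.+1) := delta_mx 0 i0.
have le2 := leqW (leqnn n1); have le3 := leqW le2; have le4 := leqW le3.
have Icv : entries I (c *: v) by move=> a b; rewrite mxE mulrC; case: idI => _ _; apply.
(* The vector c v delta has entries in c I, so it is sigma u0 = u delta delta. Hence c v - u delta
   is a cycle w d = w delta, and f = u + w satisfies f delta = c v. *)
have [u0 hu0] : exists u0, c *: v *m delta n1 = sigma *: u0.
  have /choice[u hu] j : exists r, (c *: v *m delta n1) 0 j = r * sigma.
    by rewrite -scalemxAl mxE; apply: c_socle; apply: entriesMl.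
  by exists (\row_j u j); apply/rowP => j; rewrite hu [RHS]mxE mxE mulrC.
have [u hu] := E_surj u0 (leqnn n1).
have [||w Iw hw] := @cycleI_boundary n1 (c *: v - u *m delta n1.+1) (leqnn _).
- by apply: entriesD => //; apply: entriesN => //; apply: entriesMl.
- rewrite mulmxBl mul_entriesI // [u *m _ *m d _]mul_entriesI; last exact: entriesMl.
  by rewrite hu hu0 subrr.
pose f := u + w.
have fE : f *m delta n1.+1 = c *: v.
  by rewrite mulmxDl -(mul_entriesI Iw) -hw addrC subrK.
have Iscale r p q (A : 'M_(p, q)) : I r -> entries I (r *: A).
  by move=> Ir a b; rewrite mxE mulrC; case: idI => _ _; apply.
have scale_d r q (A : 'M_(q, rk n1.+2)) : I r ->
    r *: A *m d n1.+1 = r *: (A *m delta n1.+1).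
  by move=> Ir; rewrite mul_entriesI -?scalemxAl //; apply: Iscale.
(* Modulo ker rho, e solves e E = v. As x f delta = x c v = sigma v, the vector x f - e delta is a
   cycle. *)
have [e he] := E_surj v le2.
have [||g Ig hg] := @cycleI_boundary n1.+1 (x *: f - e *m delta n1.+2) le2.
- apply: entriesD => //; first exact: Iscale.
  by apply: entriesN => //; apply: entriesMl.
- rewrite mulmxBl scale_d // [e *m _ *m d _]mul_entriesI; last exact: entriesMl.
  by rewrite fE he scalerA mulrC cx subrr.
have [||g' Ig' hg'] := @cycleI_boundary n1.+1 (x' *: f) le2.
- exact: Iscale.
- by rewrite scale_d // fE scalerA mulrC cx' scale0r.
(* Applying d gives x' (x f) - x (x' f) = 0, so this vector is a cycle. *)
have Iz : entries I (x' *: e + x' *: g - x *: g').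
  apply: entriesD => //; first by apply: entriesD => //; apply: Iscale.
  by apply: entriesN => //; apply: Iscale.
have [|h Ih hh] := @cycleI_boundary n1.+2 _ le3 Iz.
  rewrite mulmxBl mulmxDl [x' *: e *m d _]mul_entriesI; last exact: Iscale.
  rewrite -!scalemxAl -hg -hg' -scalerDr [e *m _ + _]addrC subrK !scalerA.
  by rewrite mulrC subrr.
have Qxe : entries Q (x' *: e).
  have Qmul p q r (A : 'M_(p, q)) (B : 'M_(q, r)) :
      map_mx rho A = 0 -> map_mx rho B = 0 -> entries Q (A *m B).
    case: dec => [_ _ [_ _ _ QM] _ _] A0 B0 a b.
    rewrite mxE; apply: (ideal_sum idQ) => l _; apply: QM.
      by have := congr1 (fun C : 'M_(_, _) => C a l) A0; rewrite !mxE.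
    by have := congr1 (fun C : 'M_(_, _) => C l b) B0; rewrite !mxE.
  have Qscale y p q (A : 'M_(p, q)) : I y -> entries I A -> entries Q (y *: A).
    case: dec => [_ _ [_ _ _ QM] _ _] Iy IA a b.
    by rewrite mxE; apply: QM; apply: Irho.
  (* All three terms on the right are sums of products of two elements of ker rho. *)
  have -> : x' *: e = h *m d n1.+3 - (x' *: g - x *: g').
    by rewrite -hh -(addrA (x' *: e)) addrK.
  apply: entriesD => //; first by apply: Qmul => //; apply: entries_rho dec _ _ _ Ih.
  apply: entriesN => //; apply: entriesD => //; first exact: Qscale.
  by apply: entriesN => //; apply: Qscale.
(* If e were zero over k, so would be e E, which is the basis vector v there. *)
have [j [y ey]] : exists j y, e 0 j * y = 1.
  apply: (rho_neq0 dec); apply/eqP => e0; case: sn0.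
  move: he; rewrite -mulmxA delta2 -scalemxAr => /esym/(sigma_scale dec).
  rewrite map_mxM e0 mul0mx => /(congr1 (fun A : 'rV_ _ => A 0 i0)).
  by rewrite !mxE !eqxx rmorph1 => /eqP; rewrite oner_eq0.
case: Qx'; have := Qxe 0 j; rewrite mxE => Qxej.
rewrite -[x']mulr1 -ey mulrA mulrC; by case: idQ => _ _; apply.
Qed.

End Typeless.

Lemma typeless_rank_eq0 (M : lmodType R) (F : free_resolution M) n0 :
  minimal_resolution rho F ->
  (forall n, (n0 <= n)%N -> ~ type_at rho F I n) ->
  (forall n, (n0 <= n)%N -> ~ type_at rho F J n) ->
  exists n, fr_rank F n = 0.
Proof.
move=> minF notI notJ.
pose mx n := 'M[R]_(fr_rank F n.+1, fr_rank F n).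
have ex n : exists de : mx n * mx n,
    [/\ entries I de.1, entries J de.2 & fr_d F n = de.1 + de.2].
  by have [b [c' h]] := rho_split dec (minF n); exists (b, c').
pose delta n := (projT1 (cid (ex n))).1; pose eps n := (projT1 (cid (ex n))).2.
have deltaI n : entries I (delta n) by case: (projT2 (cid (ex n))).
have epsJ n : entries J (eps n) by case: (projT2 (cid (ex n))).
have dE n : fr_d F n = delta n + eps n by case: (projT2 (cid (ex n))).
have [_ [idI idJ _] _ _ _] := dec.
have exE n : exists E, delta n.+1 *m delta n = sigma *: E.
  apply: (entries_cap dec); first exact: entriesMl.
  (* Being also -eps^2, the product has entries in both I and J, hence in the ideal of sigma. *)
  have -> : delta n.+1 *m delta n = - (eps n.+1 *m eps n).
    apply/eqP; rewrite -addr_eq0 -(fr_dd F n) !dE mulmxDl !mulmxDr.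
    rewrite (entries_mul0 dec (@deltaI _) (@epsJ _)).
    by rewrite (entries_mul0 (decomposedC dec) (@epsJ _) (@deltaI _)) addr0 add0r.
  by apply: entriesN => //; apply: entriesMl.
pose E n := projT1 (cid (exE n)); have EP n := projT2 (cid (exE n)).
have le n := @rank_le M F n0 minF notI notJ delta eps E deltaI epsJ dE EP n.
(* The increment of r at n is rank F_{n+2} - rank F_n, so r is nonincreasing and its stationarity is
   2-periodicity of the ranks. *)
pose r n := (fr_rank F n + fr_rank F n.+1)%N.
have [|n n0n st] := @nonincreasing_stationary r n0.
  by move=> n n0n; rewrite /r addnC leq_add2r le.
exists n.+1.
apply: (@typeless_rank0 M F n0 minF notI notJ delta eps E deltaI epsJ dE EP n n0n).
move=> l nl; have := st l.+1 (leqW nl); rewrite -(st l nl) /r [RHS]addnC.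
by move/addnI.
Qed.

End TypesOfModules.

(** * Tor-vanishing for rings with a decomposed maximal ideal *)

Section TorVanishing.
Variables (k : fieldType) (R : comPzRingType) (rho : {rmorphism R -> k}).

Lemma projective_rV n : projective_module 'rV[R]_n.
Proof.
move=> A B f h surj.
have /choice[a ha] i : exists x, f x = h (delta_mx 0 i) by exact: surj.
exists (combination a) => u; rewrite linear_sum [u in RHS]row_sum_delta linear_sum.
by apply: eq_bigr => i _; rewrite !linearZ_LR ha.
Qed.

(** Once F_l = 0, every vector of F_{l+1} is a boundary, so by minimality a basis vector would be
    zero over k; zero ranks therefore propagate. *)
Lemma rank0_finite_projdim (M : lmodType R) (F : free_resolution M) n :
  minimal_resolution rho F -> fr_rank F n = 0 -> finite_projdim M.
Proof.
move=> minF rk0.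
have rk0S l : fr_rank F l = 0 -> fr_rank F l.+1 = 0.
  move=> l0; apply/eqP; rewrite -leqn0 leqNgt; apply/negP => gt0.
  pose i := Ordinal gt0.
  have [|w hw] := @fr_exactP _ _ F l _ (delta_mx 0 i : 'rV_(fr_rank F l.+1)).
    by apply/matrixP => a [b blt]; exfalso; move: blt; rewrite l0.
  have := congr1 (fun A => map_mx rho A 0 i) hw.
  rewrite map_mxM minF mulmx0 !mxE !eqxx rmorph1 => /eqP.
  by rewrite oner_eq0.
exists (fun l => 'rV_(fr_rank F l)), (fun l => mulmxr (fr_d F l)), (fr_aug F).
split.
- by move=> l; apply: projective_rV.
- exact: fr_aug_surj.
- exact: fr_exact0.
- exact: fr_exact.
exists n => l /ltnW nl u.
suff l0 : fr_rank F l = 0 by apply/rowP => -[b blt]; exfalso; move: blt; rewrite l0.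
by rewrite -(subnKC nl); elim: (l - n)%N => [|j IHj]; rewrite ?addn0 // addnS rk0S.
Qed.

Variables (I J Q : set R) (sigma c x x' : R).
Hypothesis dec : decomposed rho I J Q sigma.
Hypothesis Ic : I c.
Hypothesis c_socle : forall a, I a -> exists r, c * a = r * sigma.
Hypotheses (Ix : I x) (cx : c * x = sigma).
Hypotheses (Ix' : I x') (cx' : c * x' = 0) (Qx' : ~ Q x').

Lemma decomposed_Tor_vanishing : ideal_fg R -> Tor_vanishing R.
Proof.
move=> Rnoeth M N fgM fgN [l0 Tor0].
have unit : forall x, rho x != 0 -> exists y, x * y = 1 by case: dec => [[]].
have [F minF] := minimal_resolution_exists unit Rnoeth fgM.
have [G minG] := minimal_resolution_exists unit Rnoeth fgN.
have rank0 := typeless_rank_eq0 dec Ic c_socle Ix cx Ix' cx' Qx'.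
case: (pselect (exists n, fr_rank F n = 0)) => [[n /rank0_finite_projdim]|Fn0].
  by left; auto.
(* By [type_at_step] one type forces the other one degree later, so if either never occurred F would
   have no type at all and would reach rank 0. *)
right; have [a [b [Fa Fb]]] : exists a b, type_at rho F I a /\ type_at rho F J b.
  apply: contrapT => noab; case: Fn0.
  apply: (rank0 M F 0%N minF) => n _ Fn; apply: noab.
    by exists n, n.+1; split=> //; apply: type_at_step dec _ _ minF _ Fn.
  by exists n.+1, n; split=> //; apply: type_at_step (decomposedC dec) _ _ minF _ Fn.
have exact i j : (l0 <= j)%N -> tor_exact F G i j.+1.
  by move=> lj; apply: Tor_zero_exact; apply: Tor0;
    rewrite addnS !leqW // (leq_trans lj) ?leq_addl.
(* The two types of F, in the fixed degrees a and b, exclude both types of G in all high degrees. *)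
have [||n /rank0_finite_projdim] := rank0 N G l0 minG.
- move=> n ln; apply: (tor_exact_types (decomposedC dec) minF minG (exact _ _ ln) Fb).
- move=> n ln; apply: (tor_exact_types dec minF minG (exact _ _ ln) Fa).
- by auto.
Qed.

End TorVanishing.

(** * Socle elements of an Artinian local ring *)

Section ArtinianLocalRing.
Variables (k : fieldType) (S : comNzRingType) (m : set S).
Variables (p : {rmorphism S -> k}) (s : S).
Hypothesis locS : local_ring m.
Hypothesis resS : residue_map m p.

Definition principal (x : S) : set S := [set y | exists a, y = a * x].

Lemma principal_ideal x : is_ideal (principal x).
Proof.
split=> [|_ _ [a ->] [b ->]|b _ [a ->]].
- by exists 0; rewrite mul0r.
- by exists (a + b); rewrite mulrDl.
- by exists (b * a); rewrite mulrA.
Qed.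

Lemma principal_id x : principal x x.
Proof. by exists 1; rewrite mul1r. Qed.

Lemma local_unit x : p x != 0 -> exists y, x * y = 1.
Proof.
case: locS resS => _ [_ m_proper _] m_unique [_ kerp] px.
apply: contrapT => x_nonunit.
pose proper (A : set S) := [/\ is_ideal A, ~ A 1 & A x].
have [|A [PA Amax]] := @Zorn_bigcup S (fun A => A = set0 \/ proper A).
  move=> F FP Ftot; case: (pselect (exists2 A, F A & A x)) => [[A0 FA0 A0x]|noA].
    right; have Fx A y : F A -> A y -> proper A.
      by move=> FA Ay; case: (FP A FA) => // A_0; rewrite A_0 in Ay.
    split; last by exists A0.
      split.
      - by exists A0 => //; case: (Fx _ _ FA0 A0x) => -[].
      - move=> a b [A FA Aa] [B FB Bb].
        have [AB|BA] := Ftot _ _ FA FB.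
          by exists B => //; have [[_ BD _] _ _] := Fx _ _ FB Bb;
            apply: BD => //; apply: AB.
        by exists A => //; have [[_ AD _] _ _] := Fx _ _ FA Aa;
          apply: AD => //; apply: BA.
      - move=> a b [A FA Ab]; exists A => //.
        by have [[_ _ AM] _ _] := Fx _ _ FA Ab; apply: AM.
    by case=> A FA A1; case: (Fx _ _ FA A1).
  left; rewrite predeqE => y; split=> // -[A FA Ay].
  case: (FP A FA) => [A_0|[_ _ Ax]]; first by rewrite A_0 in Ay.
  by case: noA; exists A.
have properx : proper (principal x).
  split; [exact: principal_ideal | | exact: principal_id].
  by case=> a a1; apply: x_nonunit; exists a; rewrite mulrC.
case: PA => [A_0|[idA A1 Ax]].
  apply: (Amax (principal x)); last by right.
  by rewrite A_0; split=> // /(_ x (principal_id x)).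
have maxA : maximal_ideal A.
  split=> // B idB B1 AB; apply: contrapT => BA; apply: (Amax B); last first.
    by right; split=> //; apply: AB.
  by split=> // BsubA; apply: BA; apply/seteqP.
by move: px; rewrite (kerp x).2 ?eqxx // -(m_unique _ maxA).
Qed.

Definition max_square : set S := [set z | exists r (a b : 'I_r -> S),
  (forall i, m (a i) /\ m (b i)) /\ z = \sum_i a i * b i].

Lemma max_ideal : is_ideal m.
Proof. by case: locS => _ []. Qed.

Lemma max_squareM a b : m a -> m b -> max_square (a * b).
Proof.
by move=> ma mb; exists 1, (fun=> a), (fun=> b); rewrite big_ord1.
Qed.

Lemma max_square_ideal : is_ideal max_square.
Proof.
have [m0 _ mM] := max_ideal.
split=> [|_ _ [q [a [b [ab ->]]]] [r [c [d [cd ->]]]]|e _ [q [a [b [ab ->]]]]].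
- by exists 0, (fun=> 0), (fun=> 0); split; [case | rewrite big_ord0].
- exists (q + r)%N, (join_ord a c), (join_ord b d).
  split=> [i|]; first by rewrite /join_ord; case: fintype.split.
  rewrite big_split_ord; congr (_ + _); apply: eq_bigr => i _.
    by rewrite !join_ordl.
  by rewrite !join_ordr.
- exists q, (fun i => e * a i), b; split=> [i|].
    by case: (ab i) => ma mb; split=> //; apply: mM.
  by rewrite mulr_sumr; apply: eq_bigr => i _; rewrite mulrA.
Qed.

(** Determinant trick: the column g of generators of m satisfies (1 - A) g in L with A over m, and
    det (1 - A) is a unit. *)
Lemma nakayama_max (L : set S) : is_ideal L ->
  (forall z, m z -> exists2 a, max_square a & L (z - a)) -> forall z, m z -> L z.
Proof.
move=> [L0 LD LM] mL; have [noeth _ _] := locS; have [_ kerp] := resS.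
have [m0 mD mM] := max_ideal.
have [g gP] := noeth m max_ideal.
have gm i : m g`_i.
  have [ilt|ige] := ltnP i (size g); last by rewrite nth_default.
  apply/gP; exists (fun j => (j == Ordinal ilt)%:R).
  rewrite (bigD1 (Ordinal ilt)) //= eqxx mul1r big1 ?addr0 // => j /negbTE->.
  by rewrite mul0r.
have sqP a : max_square a ->
    exists2 c : 'I_(size g) -> S, (forall j, m (c j)) & a = \sum_j c j * g`_j.
  case=> r [b [c [bc ->]]].
  have /choice[e he] i : exists e : 'I_(size g) -> S, c i = \sum_j e j * g`_j.
    by apply/gP; case: (bc i).
  exists (fun j => \sum_i b i * e i j) => [j|].
    apply: (big_ind m) => // i _; rewrite mulrC; apply: mM.
    by case: (bc i).
  rewrite (eq_bigr _ (fun i _ => congr1 (fun z => b i * z) (he i))).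
  under eq_bigr do rewrite mulr_sumr.
  rewrite exchange_big; apply: eq_bigr => j _ /=; rewrite mulr_suml.
  by apply: eq_bigr => i _; rewrite mulrA.
have /choice[A hA] (i : 'I_(size g)) : exists c : 'I_(size g) -> S,
    (forall j, m (c j)) /\ L (g`_i - \sum_j c j * g`_j).
  by have [a /sqP[c mc ->] La] := mL _ (gm i); exists c.
pose B := 1%:M - \matrix_(i, j) A i j.
pose v := \col_i g`_i : 'cV_(size g).
have LB i : L ((B *m v) i 0).
  have -> : (B *m v) i 0 = g`_i - \sum_j A i j * g`_j.
    rewrite mulmxBl mul1mx !mxE; congr (_ - _).
    by apply: eq_bigr => j _; rewrite !mxE.
  by case: (hA i).
have [u hu] : exists u, \det B * u = 1.
  apply: local_unit; rewrite -det_map_mx map_mxB map_mx1.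
  suff -> : map_mx p (\matrix_(i, j) A i j) = 0 by rewrite subr0 det1 oner_neq0.
  by apply/matrixP => i j; rewrite !mxE; apply/kerp; case: (hA i).
have Lg i : L g`_i.
  have [ilt|ige] := ltnP i (size g); last by rewrite nth_default.
  suff -> : g`_i = u * (\adj B *m (B *m v)) (Ordinal ilt) 0.
    apply: (LM); rewrite mxE; apply: (big_ind L) => // j _.
    exact: LM.
  by rewrite mulmxA mul_adj_mx mul_scalar_mx !mxE /= mulrA [u * _]mulrC hu mul1r.
by move=> z /gP[c ->]; apply: (big_ind L) => // i _; apply: LM.
Qed.

Hypothesis artS : artinian S.
Hypothesis socS : socle_generator m s.
Hypothesis lenS : length_ge S 3.

Lemma socleP x : (exists a, x = a * s) <-> forall a, m a -> a * x = 0.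
Proof.
case: socS => _ socE; have := congr1 (fun A : set S => A x) socE.
by rewrite /socle /= => ->.
Qed.

Lemma mul_socle a : m a -> a * s = 0.
Proof. by apply: (socleP s).1; exists 1; rewrite mul1r. Qed.

(** Otherwise m = (s) is killed by m and leaves no room for a chain of length 3: I_2 lies in m, a
    nonzero element of I_1 outside I_0 is a unit times s, so s is in I_1 and I_2 is not larger than
    I_1. *)
Lemma max_not_socle : exists2 y, m y & ~ exists a, y = a * s.
Proof.
have [_ kerp] := resS; have [s0 _] := socS.
apply: contrapT => h.
have sub y : m y -> exists a, y = a * s.
  by move=> my; apply: contrapT => ny; apply: h; exists y.
case: lenS => I [idI ltI].
have [I1id I2id I3id] := And3 (idI 1%N isT) (idI 2%N isT) (idI 3%N isT).
have I2m y : I 2%N y -> m y.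
  move=> Iy; apply/kerp/eqP/contraT => /local_unit[z yz].
  have [_ []] := ltI 2%N isT; move=> w _.
  by case: I2id => _ _ IM; rewrite -[w]mulr1 -yz [y * z]mulrC mulrA; apply: IM.
have [sub01 n01] := ltI 0%N isT; have [sub12 n12] := ltI 1%N isT.
case: n12 => y /I2m/sub[a ->].
have [z Iz nz] : exists2 z, I 1%N z & ~ I 0%N z.
  apply: contrapT => nz; apply: n01 => z Iz.
  by apply: contrapT => nIz; apply: nz; exists z.
have [b zb] := sub z (I2m z (sub12 z Iz)).
have : p b != 0.
  apply/eqP => /kerp mb; apply: nz.
  by rewrite zb mul_socle //; case: (idI 0%N isT).
case/local_unit => b' bb'; case: I1id => _ _ IM; apply: (IM).
by rewrite -[s]mul1r -bb' -mulrA mulrCA -zb; apply: IM.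
Qed.

(** This is m^2 + (s). With s included, membership of a coordinate does not depend on the
    representative in the fiber product, which varies by multiples of (s, -t). *)
Definition square_socle : set S :=
  [set z | exists a b, max_square a /\ z = a + b * s].

Lemma square_socle_ideal : is_ideal square_socle.
Proof.
have [q0 qD qM] := max_square_ideal.
split=> [|_ _ [a [b [qa ->]]] [c [d [qc ->]]]|e _ [a [b [qa ->]]]].
- by exists 0, 0; rewrite mul0r addr0.
- by exists (a + c), (b + d); split; [apply: qD | rewrite mulrDl addrACA].
- by exists (e * a), (e * b); split; [apply: qM | rewrite mulrDr mulrA].
Qed.

Lemma max_not_square_socle : exists2 y, m y & ~ square_socle y.
Proof.
have [y my ny] := max_not_socle; apply: contrapT => h; apply: ny.
apply: (@nakayama_max (principal s)) my; first exact: principal_ideal.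
move=> z mz; have [a [b [qa zE]]] : square_socle z.
  by apply: contrapT => nz; apply: h; exists z.
by exists a => //; exists b; rewrite zE addrAC subrr add0r.
Qed.

(** Here c is in the second socle but not in the socle. If there were none, any element of m outside
    the socle could be multiplied by an element of m and stay outside, and the resulting chain of
    principal ideals would never stop. As c x0 is a nonzero, hence unit, multiple of s, rescaling x0
    gives x. *)
Lemma second_socle : exists c x,
  [/\ m c, m x, c * x = s & forall a, m a -> exists r, c * a = r * s].
Proof.
have [m0 _ mM] := max_ideal; have [_ kerp] := resS.
have [c [mc nc hc]] : exists c, [/\ m c, ~ (exists a, c = a * s) &
    forall a, m a -> exists r, c * a = r * s].
  apply: contrapT => h.
  have /choice[f hf] c : exists a, m c /\ ~ (exists a, c = a * s) ->
      m a /\ ~ exists b, c * a = b * s.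
    case: (pselect (m c /\ ~ (exists a, c = a * s))) => [[mc nc]|]; last by exists 0.
    apply: contrapT => na; apply: h; exists c; split=> // a ma.
    by apply: contrapT => nr; apply: na; exists a.
  have [y my ny] := max_not_socle.
  pose u i := iter i (fun c => c * f c) y.
  have uP i : m (u i) /\ ~ exists a, u i = a * s.
    elim: i => [|i IHi] //; have [mf nf] := hf _ IHi.
    by split=> //=; apply: mM.
  have [||N hN] := artS (I := fun i => principal (u i)).
  - by move=> i; apply: principal_ideal.
  - by move=> i _ [a ->]; exists (a * f (u i)); rewrite /= -mulrA [f _ * _]mulrC.
  have [a ha] : principal (u N.+1) (u N).
    by rewrite (hN N.+1 (leqnSn N)); apply: principal_id.
  have [[_ uN] [mf _]] := (uP N, hf _ (uP N)).
  have [z hz] : exists z, (1 - a * f (u N)) * z = 1.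
    apply: local_unit; rewrite rmorphB rmorph1.
    suff -> : p (a * f (u N)) = 0 by rewrite subr0 oner_neq0.
    by apply/kerp; apply: mM.
  (* From u_N = a f(u_N) u_N with f(u_N) in m one gets u_N = 0, which is in the socle. *)
  apply: uN; exists 0; rewrite mul0r -[LHS]mul1r -hz mulrAC.
  suff -> : (1 - a * f (u N)) * u N = 0 by rewrite mul0r.
  have uS : u N.+1 = u N * f (u N) by [].
  by rewrite mulrBl mul1r {1}ha uS -mulrA [f _ * _]mulrC subrr.
have [x0 mx0 ncx0] : exists2 x, m x & c * x <> 0.
  apply: contrapT => h; apply: nc; apply/socleP => a ma.
  by rewrite mulrC; apply: contrapT => ca; apply: h; exists a.
have [r hr] := hc _ mx0.
have /local_unit[r' rr'] : p r != 0.
  by apply/eqP => /kerp mr; apply: ncx0; rewrite hr mul_socle.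
exists c, (r' * x0); split=> //; first exact: mM.
by rewrite mulrCA hr mulrA [r' * r]mulrC rr' mul1r.
Qed.

Hypothesis edimS : embdim_ge m 2.

(** For y in m, c y = r s = r c x, so c kills y - r x. If all such elements were in m^2 + (s), then,
    as s = c x, Nakayama would give m = (x), against embedding dimension at least 2. *)
Lemma second_socle_annihilator : exists c x x',
  [/\ [/\ m c, m x & m x'], c * x = s, c * x' = 0, ~ square_socle x' &
      forall a, m a -> exists r, c * a = r * s].
Proof.
have [c [x [mc mx cx hc]]] := second_socle; exists c, x.
have [m0 mD mM] := max_ideal; have [q0 qD qM] := max_square_ideal.
suff [x' [mx' cx' nx']] : exists x', [/\ m x', c * x' = 0 & ~ square_socle x'].
  by exists x'.
apply: contrapT => h.
have : (2 <= size [:: x])%N; last by [].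
apply: edimS => z; split=> [mz|[a ->]]; last by rewrite big_ord1; apply: mM.
suff [a ->] : exists a, z = a * x by exists (fun=> a); rewrite big_ord1.
apply: (@nakayama_max (principal x)) mz => [|y my]; first exact: principal_ideal.
have [r hr] := hc y my.
have [a [b [qa yE]]] : square_socle (y - r * x).
  apply: contrapT => ny; apply: h; exists (y - r * x); split=> //.
    by apply: mD => //; rewrite -mulNr; apply: mM.
  by rewrite mulrBr hr mulrCA cx subrr.
exists a => //; exists (b * c + r).
by rewrite -[y](subrK (r * x)) yE -(addrA a) addrAC subrr add0r mulrDl -mulrA cx.
Qed.

End ArtinianLocalRing.

(** * The decomposition of the maximal ideal of S # T *)

Section ConnectedSum.
Variables (k : fieldType) (S T : comNzRingType) (m : set S) (n : set T).
Variables (piS : {rmorphism S -> k}) (piT : {rmorphism T -> k}) (s : S) (t : T).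

Local Notation fiber := (fiber_product piS piT).
Local Notation csum := (connected_sum piS piT s t).
Definition csum_pi (a : fiber) : csum :=
  (\pi_(Quotient.quot (@connected_ideal k S T piS piT s t)) a)%qT.

Lemma csum_pi_zmod_morphism : zmod_morphism csum_pi.
Proof. exact: raddfB. Qed.

Lemma csum_pi_monoid_morphism : monoid_morphism csum_pi.
Proof. by split=> // a b; rewrite /csum_pi -csum_piM. Qed.

HB.instance Definition _ :=
  GRing.isZmodMorphism.Build fiber csum csum_pi csum_pi_zmod_morphism.
HB.instance Definition _ :=
  GRing.isMonoidMorphism.Build fiber csum csum_pi csum_pi_monoid_morphism.

Local Notation pr := csum_pi.

Lemma fiber_exists x y : piS x = piT y -> exists z : fiber, val z = (x, y).
Proof.
move=> xy; have h : (x, y) \in fiber_pred piS piT by apply/eqP.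
by exists (FiberProduct h).
Qed.

Lemma fiberP (z : fiber) : piS (val z).1 = piT (val z).2.
Proof. by apply/eqP; case: z. Qed.

Lemma fiber_val0 : val (0 : fiber) = 0. Proof. exact: raddf0. Qed.
Lemma fiber_val1 : val (1 : fiber) = 1. Proof. exact: rmorph1. Qed.
Lemma fiber_valB (a b : fiber) : val (a - b) = val a - val b.
Proof. exact: raddfB. Qed.
Lemma fiber_valD (a b : fiber) : val (a + b) = val a + val b.
Proof. exact: raddfD. Qed.
Lemma fiber_valM (a b : fiber) : val (a * b) = val a * val b.
Proof. exact: rmorphM. Qed.
Lemma fiber_val_sum r (f : 'I_r -> fiber) : val (\sum_i f i) = \sum_i val (f i).
Proof. exact: raddf_sum. Qed.

Lemma csum_surj (z : csum) : exists a, z = pr a.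
Proof. exact: csum_piP. Qed.

Lemma csum_eq a b : pr a = pr b <->
  exists c : fiber, val a - val b = val c * (s, - t).
Proof.
split=> [/eqP|[c hc]].
  rewrite -Quotient.idealrBE => /asboolP[c hc].
  by exists c; rewrite -hc fiber_valB.
apply/eqP; rewrite -Quotient.idealrBE; apply/asboolP.
by exists c; rewrite fiber_valB.
Qed.

Hypotheses (locS : local_ring m) (locT : local_ring n).
Hypotheses (resS : residue_map m piS) (resT : residue_map n piT).
Hypotheses (socS : socle_generator m s) (socT : socle_generator n t).
Hypotheses (ms : m s) (nt : n t).

Definition csum_rho (z : csum) : k := piS (val (repr z)).1.

Lemma csum_rhoE a : csum_rho (pr a) = piS (val a).1.
Proof.
rewrite /csum_rho.
have /csum_eq[c /(congr1 fst)/= hc] : pr (repr (pr a)) = pr a.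
  exact: reprK.
apply/eqP; rewrite -subr_eq0 -rmorphB hc rmorphM.
by have [_ kerp] := resS; rewrite (kerp s).2 ?mulr0.
Qed.

Lemma csum_rho_zmod_morphism : zmod_morphism csum_rho.
Proof.
move=> x y; have [a ->] := csum_surj x; have [b ->] := csum_surj y.
by rewrite -raddfB !csum_rhoE !raddfB.
Qed.

Lemma csum_rho_monoid_morphism : monoid_morphism csum_rho.
Proof.
split=> [|x y]; first by rewrite -[1]/(pr 1) csum_rhoE !rmorph1.
have [a ->] := csum_surj x; have [b ->] := csum_surj y.
by rewrite -(rmorphM csum_pi) !csum_rhoE !rmorphM.
Qed.

HB.instance Definition _ :=
  GRing.isZmodMorphism.Build csum k csum_rho csum_rho_zmod_morphism.
HB.instance Definition _ :=
  GRing.isMonoidMorphism.Build csum k csum_rho csum_rho_monoid_morphism.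

(** If the second coordinate of a fiber product element vanishes, the first is in m; this is thus
    the image of m. *)
Definition csumI : set csum := [set z | exists2 a : fiber, (val a).2 = 0 & z = pr a].
Definition csumJ : set csum := [set z | exists2 a : fiber, (val a).1 = 0 & z = pr a].
Definition csumQ : set csum := [set z | exists2 a : fiber,
  square_socle m s (val a).1 /\ square_socle n t (val a).2 & z = pr a].

Lemma fiber_max (a : fiber) : piS (val a).1 = 0 -> m (val a).1 /\ n (val a).2.
Proof.
have [[_ kerS] [_ kerT]] := (resS, resT).
by move=> a0; split; [apply/kerS | apply/kerT; rewrite -fiberP].
Qed.

Lemma max_kerS x : m x -> piS x = 0.
Proof. by have [_ kerS] := resS => /kerS. Qed.

Lemma max_kerT y : n y -> piT y = 0.
Proof. by have [_ kerT] := resT => /kerT. Qed.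

Lemma inS_exists x : m x -> exists a : fiber, val a = (x, 0).
Proof. by move=> mx; apply: fiber_exists; rewrite max_kerS ?rmorph0. Qed.

Lemma inT_exists y : n y -> exists a : fiber, val a = (0, y).
Proof. by move=> ny; apply: fiber_exists; rewrite max_kerT ?rmorph0. Qed.

Lemma lift_fstS x : exists a : fiber, (val a).1 = x.
Proof.
have [surjT _] := resT; have [y hy] := surjT (piS x).
by have [a ha] := fiber_exists (esym hy); exists a; rewrite ha.
Qed.

Lemma lift_sndT y : exists a : fiber, (val a).2 = y.
Proof.
have [surjS _] := resS; have [x hx] := surjS (piT y).
by have [a ha] := fiber_exists hx; exists a; rewrite ha.
Qed.

Lemma csumQ_fst a : csumQ (pr a) -> square_socle m s (val a).1.
Proof.
case=> b [[u [v [qu b1]]] b2] /csum_eq[c /(congr1 fst)/= hc].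
exists u, (v + (val c).1); split=> //.
by rewrite mulrDl addrA -b1 -hc addrC subrK.
Qed.

Lemma csumQ_snd a : csumQ (pr a) -> square_socle n t (val a).2.
Proof.
case=> b [b1 [u [v [qu b2]]]] /csum_eq[c /(congr1 snd)/= hc].
exists u, (v - (val c).2); split=> //.
by rewrite mulrBl addrA -b2 -mulrN -hc addrC subrK.
Qed.

Lemma csum_decomposed sg x y : val sg = (s, 0) ->
  m x -> ~ square_socle m s x -> n y -> ~ square_socle n t y ->
  decomposed csum_rho csumI csumJ csumQ (pr sg).
Proof.
move=> sgE mx nx ny nny.
have idS := square_socle_ideal s locS; have idT := square_socle_ideal t locT.
have [[s0 _] [t0 _]] := (socS, socT).
(* The class sigma is that of (s, 0) and of (0, t), which differ by (s, -t). *)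
have prJ (a : fiber) : val a = (0, t) -> pr a = pr sg.
  move=> aE; apply/csum_eq; exists (- 1); rewrite aE sgE rmorphN1.
  by congr (_, _); rewrite /= ?sub0r ?subr0 ?mulN1r ?opprK.
rewrite /decomposed /=; split.
- split.
  + move=> a; have [surjS _] := resS; have [u <-] := surjS a.
    by have [z hz] := lift_fstS u; exists (pr z); rewrite csum_rhoE hz.
  + move=> z; have [a ->] := csum_surj z; rewrite csum_rhoE => a0.
    have [u hu] := local_unit locS resS a0.
    have [|v hv] := local_unit locT resT (x := (val a).2); first by rewrite -fiberP.
    have [|b hb] := @fiber_exists u v.
      apply: (mulfI a0); rewrite -rmorphM hu fiberP -rmorphM hv.
      by rewrite !rmorph1.
    exists (pr b); rewrite -(rmorphM csum_pi); congr (pr _); apply: val_inj.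
    by rewrite fiber_valM fiber_val1 hb; congr (_, _).
  + move=> z; have [a ->] := csum_surj z; rewrite csum_rhoE => /fiber_max[ma na].
    have [[b hb] [c hc]] := (inS_exists ma, inT_exists na).
    exists (pr b), (pr c).
    split; [by exists b; rewrite ?hb | by exists c; rewrite ?hc|].
    rewrite -(raddfD csum_pi); congr (pr _); apply: val_inj; rewrite fiber_valD hb hc.
    by rewrite [LHS]surjective_pairing; congr (_, _); rewrite /= ?addr0 ?add0r.
- split.
  + split=> [|_ _ [a a0 ->] [b b0 ->]|z _ [a a0 ->]].
    * by exists 0; rewrite ?fiber_val0 ?raddf0.
    * by exists (a + b); rewrite ?(raddfD csum_pi) // fiber_valD /= a0 b0 addr0.
    * have [b ->] := csum_surj z; exists (b * a); rewrite ?(rmorphM csum_pi) //.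
      by rewrite fiber_valM /= a0 mulr0.
  + split=> [|_ _ [a a0 ->] [b b0 ->]|z _ [a a0 ->]].
    * by exists 0; rewrite ?fiber_val0 ?raddf0.
    * by exists (a + b); rewrite ?(raddfD csum_pi) // fiber_valD /= a0 b0 addr0.
    * have [b ->] := csum_surj z; exists (b * a); rewrite ?(rmorphM csum_pi) //.
      by rewrite fiber_valM /= a0 mulr0.
  + case: idS idT => S0 SD SM [T0 TD TM].
    split=> [|_ _ [a [a1 a2] ->] [b [b1 b2] ->]|z _ [a [a1 a2] ->]].
    * by exists 0; rewrite ?fiber_val0 ?raddf0.
    * exists (a + b); rewrite ?(raddfD csum_pi) // fiber_valD /=.
      by split; [apply: SD | apply: TD].
    * have [b ->] := csum_surj z; exists (b * a);
        rewrite ?(rmorphM csum_pi) // fiber_valM /=.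
      by split; [apply: SM | apply: TM].
- split.
  + by move=> _ [a a0 ->]; rewrite csum_rhoE fiberP a0 rmorph0.
  + by move=> _ [a a0 ->]; rewrite csum_rhoE a0 rmorph0.
  + move=> _ _ [a a0 ->] [b b0 ->]; rewrite -(rmorphM csum_pi).
    suff -> : a * b = 0 by rewrite raddf0.
    by apply: val_inj; rewrite fiber_valM fiber_val0; congr (_, _);
      rewrite /= ?a0 ?b0 ?mulr0 ?mul0r.
  + move=> z w; have [a ->] := csum_surj z; have [b ->] := csum_surj w.
    rewrite !csum_rhoE => /fiber_max[ma na] /fiber_max[mb nb].
    exists (a * b); rewrite ?(rmorphM csum_pi) // fiber_valM /=.
    split; [exists ((val a).1 * (val b).1), 0 | exists ((val a).2 * (val b).2), 0];
      by rewrite mul0r addr0; split=> //; apply: max_squareM.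
- split.
  + by exists sg; rewrite ?sgE.
  + by have [a ha] := inT_exists nt; exists a; rewrite ?ha // (prJ a).
  (* If (s, 0) = c (s, -t), the second coordinate of c kills t and is no unit; then the first is in
     m and kills s, so s = 0. *)
  + apply/eqP => sg0; have : pr sg = pr 0 by rewrite sg0 raddf0.
    case/csum_eq => c; rewrite sgE fiber_val0 subr0 => -[/= cs /esym/eqP ct].
    have c2 : piT (val c).2 = 0.
      apply/eqP/contraT => /(local_unit locT resT)[v hv].
      move: ct; rewrite mulrN oppr_eq0 => /eqP ct; move: t0.
      by rewrite -[t]mul1r -hv mulrAC ct mul0r eqxx.
    have [mc _] := @fiber_max c (etrans (fiberP c) c2).
    by move: s0; rewrite cs (mul_socle socS mc) eqxx.
  + move=> _ [a a0 ->] [b b0 /csum_eq[c /(congr1 fst)/= hc]].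
    exists (pr c); rewrite -(rmorphM csum_pi); congr (pr _); apply: val_inj.
    rewrite fiber_valM sgE [LHS]surjective_pairing a0; congr (_, _);
      rewrite /= ?mulr0 //.
    by move: hc; rewrite b0 subr0.
- split.
  + have [a ha] := inS_exists mx; exists (pr a); first by exists a; rewrite ?ha.
    by move/csumQ_fst; rewrite ha.
  + have [a ha] := inT_exists ny; exists (pr a); first by exists a; rewrite ?ha.
    by move/csumQ_snd; rewrite ha.
Qed.

(** Generators come from the extension given by the second projection: [KT] is the image of K in T
    and [KS] the part of K with second coordinate 0. Scalars of S and T lift to the fiber
    product. *)
Lemma csum_noetherian : ideal_fg csum.
Proof.
move=> K K0 KD KM; have [[noethS _ _] [noethT _ _]] := (locS, locT).
pose KS : set S := [set x | exists2 a : fiber, val a = (x, 0) & K (pr a)].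
pose KT : set T := [set y | exists2 a : fiber, (val a).2 = y & K (pr a)].
have [|gS gSP] := noethS KS.
  split=> [|x y [a ha Ka] [b hb Kb]|r x [a ha Ka]].
  - by exists 0; rewrite ?fiber_val0 ?raddf0.
  - exists (a + b); last by rewrite (raddfD csum_pi); apply: KD.
    by rewrite fiber_valD ha hb; congr (_, _); rewrite /= addr0.
  - have [b hb] := lift_fstS r; exists (b * a);
      last by rewrite (rmorphM csum_pi); apply: KM.
    by rewrite fiber_valM ha [val b]surjective_pairing hb;
      congr (_, _); rewrite /= mulr0.
have [|gT gTP] := noethT KT.
  split=> [|x y [a ha Ka] [b hb Kb]|r x [a ha Ka]].
  - by exists 0; rewrite ?fiber_val0 ?raddf0.
  - by exists (a + b); [rewrite fiber_valD /= ha hb |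
      rewrite (raddfD csum_pi); apply: KD].
  - have [b hb] := lift_sndT r; exists (b * a);
      last by rewrite (rmorphM csum_pi); apply: KM.
    by rewrite fiber_valM /= ha hb.
have gen (A : comNzRingType) (L : set A) g : generates L g ->
    forall i : 'I_(size g), L g`_i.
  move=> gP i; apply/gP; exists (fun j => (j == i)%:R).
  by rewrite (bigD1 i) //= eqxx mul1r big1 ?addr0 // => j /negbTE->; rewrite mul0r.
have /choice[a ha] (i : 'I_(size gS)) : exists a : fiber,
    val a = (gS`_i, 0) /\ K (pr a).
  by have [b hb Kb] := gen _ _ _ gSP i; exists b.
have /choice[b hb] (i : 'I_(size gT)) : exists b : fiber, (val b).2 = gT`_i /\ K (pr b).
  by have [c hc Kc] := gen _ _ _ gTP i; exists c.
exists (size gS + size gT)%N, (join_ord (fun i => pr (a i)) (fun i => pr (b i))) => z.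
split=> [|[u ->]]; last first.
  apply: (big_ind K) => // i _; apply: KM.
  by rewrite /join_ord; case: fintype.split => j; [case: (ha j) | case: (hb j)].
have [e ->] := csum_surj z => Ke.
have /gTP[c hc] : KT (val e).2 by exists e.
have /choice[c' hc'] i : exists c' : fiber, (val c').2 = c i by apply: lift_sndT.
pose e' := e - \sum_i c' i * b i.
have e'2 : (val e').2 = 0.
  rewrite fiber_valB /= hc fiber_val_sum raddf_sum /=; apply/eqP; rewrite subr_eq0.
  by apply/eqP/eq_bigr => i _;
    rewrite -(hb i).1 -hc' -[RHS]/(val (c' i * b i)).2 fiber_valM.
have Ke' : K (pr e').
  rewrite /e' (raddfB csum_pi) -mulN1r; apply: (KD) => //; apply: (KM).
  rewrite (raddf_sum csum_pi).
  apply: (big_ind K) => // i _ /=.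
  by rewrite (rmorphM csum_pi); apply: KM; case: (hb i).
have /gSP[d hd] : KS (val e').1.
  by exists e' => //; rewrite -e'2 -surjective_pairing.
have /choice[d' hd'] i : exists d' : fiber, (val d').1 = d i by apply: lift_fstS.
exists (join_ord (fun i => pr (d' i)) (fun i => pr (c' i))).
have -> : e = \sum_i d' i * a i + \sum_i c' i * b i.
  suff <- : e' = \sum_i d' i * a i by rewrite subrK.
  apply: val_inj; rewrite [LHS]surjective_pairing e'2 hd fiber_val_sum.
  under [RHS]eq_bigr => i _ do rewrite fiber_valM (ha i).1.
  rewrite [RHS]surjective_pairing (raddf_sum fst) (raddf_sum snd) /=.
  congr (_, _); first by apply: eq_bigr => i _; rewrite hd'.
  by rewrite big1 // => i _; rewrite mulr0.
rewrite (raddfD csum_pi) !raddf_sum big_split_ord; congr (_ + _);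
  apply: eq_bigr => i _ /=.
  by rewrite (rmorphM csum_pi) !join_ordl.
by rewrite (rmorphM csum_pi) !join_ordr.
Qed.

End ConnectedSum.

Theorem theorem4p6 (k : fieldType) (S T : comNzRingType)
    (m : set S) (n : set T)
    (piS : {rmorphism S -> k}) (piT : {rmorphism T -> k}) (s : S) (t : T)
    (locS : local_ring m) (locT : local_ring n)
    (resS : residue_map m piS) (resT : residue_map n piT)
    (artS : artinian S) (artT : artinian T)
    (gorS : gorenstein S) (gorT : gorenstein T)
    (socS : socle_generator m s) (socT : socle_generator n t)
    (golS : generalized_Golod m) (golT : generalized_Golod n)
    (lenS : length_ge S 3) (lenT : length_ge T 3)
    (edimS : embdim_ge m 2) :
  Tor_vanishing (connected_sum piS piT s t).
Proof.
have [c [x [x' [[mc mx mx'] cx cx' nx' c_soc]]]] :=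
  second_socle_annihilator locS resS artS socS lenS edimS.
(* This y gives the element of J outside Q; on the side of I that is x'. *)
have [y ny nny] := max_not_square_socle locT resT socT lenT.
have ms : m s by rewrite -cx; have [_ _] := max_ideal locS; apply.
have nt : n t.
  have [d [z [_ nz <- _]]] := second_socle locT resT artT socT lenT.
  by have [_ _] := max_ideal locT; apply.
have [sg hsg] := inS_exists piT resS ms.
have [fc hc] := inS_exists piT resS mc.
have [fx hx] := inS_exists piT resS mx.
have [fx' hx'] := inS_exists piT resS mx'.
have dec := csum_decomposed locS locT resS resT socS socT ms nt hsg mx' nx' ny nny.
have inI (a : fiber_product piS piT) u : val a = (u, 0) -> csumI (csum_pi s t a).
  by move=> ha; exists a; rewrite ?ha.
apply: (decomposed_Tor_vanishing dec (inI _ _ hc) _ (inI _ _ hx) _ (inI _ _ hx')).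
- move=> _ [a a2 ->].
  have [|ma _] := fiber_max resS resT (a := a).
    by rewrite fiberP a2 rmorph0.
  have [r hr] := c_soc _ ma; have [b hb] := lift_fstS piS resT r.
  exists (csum_pi s t b); rewrite -!rmorphM; congr (csum_pi _ _ _).
  apply: val_inj; rewrite !fiber_valM hc hsg.
  by congr (_, _); rewrite /= ?mul0r ?mulr0 // hb.
- rewrite -rmorphM; congr (csum_pi _ _ _); apply: val_inj.
  by rewrite fiber_valM hc hx hsg; congr (_, _); rewrite /= ?mul0r.
- rewrite -rmorphM; suff -> : fc * fx' = 0 by rewrite rmorph0.
  by apply: val_inj; rewrite fiber_valM hc hx' fiber_val0; congr (_, _);
    rewrite /= ?mul0r.
- by move/csumQ_fst; rewrite hx'.
- exact: csum_noetherian locS locT resS resT.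
Qed.
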